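(* Let $q\in L^1_{\mathrm{loc}}(\mathbb R)$ with $\rho(D(q))\neq\emptyset$, and let $z\in\rho(D(q))$. Then there exist two linearly independent $z$-wave functions $\Psi_-(z,\cdot)$, $\Psi_+(z,\cdot)$ associated with $q$, each unique up to constant multiples, such that for all $R\in\mathbb R$: $\Psi_-(z,\cdot)\in L^2((-\infty,R])^2$, $\Psi_+(z,\cdot)\in L^2([R,\infty))^2$; $\|\Psi_-(z,\cdot)\|_{\mathbb C^2}^{-1}\in L^2([R,\infty))$, $\|\Psi_+(z,\cdot)\|_{\mathbb C^2}^{-1}\in L^2((-\infty,R])$; $\lim_{x\to\pm\infty}\|\Psi_\pm(z,x)\|_{\mathbb C^2}=\lim_{x\to\mp\infty}\|\Psi_\pm(z,x)\|_{\mathbb C^2}^{-1}=0$; and $$\sup_{r\in\mathbb R}\Big(\int_{-\infty}^r\|\Psi_-(z,x)\|_{\mathbb C^2}^2dx\Big)\Big(\int_r^\infty\|\Psi_+(z,x)\|_{\mathbb C^2}^2dx\Big)<\infty.$$ Moreover, the $\overline z$-wave functions $\mathcal K\Psi_\pm(z,\cdot)$ satisfy the same properties with $z$ replaced by $\overline z$.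
   Context: Let $q\in L^1_{\mathrm{loc}}(\mathbb R)$. For $z\in\mathbb C$, a $z$-wave function associated with $q$ is a function $\Psi(z,\cdot)=(\psi_1(z,\cdot),\psi_2(z,\cdot))^\top\in AC_{\mathrm{loc}}(\mathbb R)^2$, not identically zero, with $\psi_1'=-iz\psi_1+q\psi_2$, $\psi_2'=iz\psi_2-\overline{q}\psi_1$ a.e.; equivalently $M(q)\Psi=z\Psi$ with $M(q)=i\begin{pmatrix}\frac{d}{dx}&-q\\-\overline q&-\frac{d}{dx}\end{pmatrix}$. $D(q)$ is the maximal operator in $L^2(\mathbb R)^2$: $D(q)F=M(q)F$ on $\{F\in L^2(\mathbb R)^2: F\in AC_{\mathrm{loc}}(\mathbb R)^2,\ M(q)F\in L^2(\mathbb R)^2\}$. $\mathcal K(a,b)^\top=(\overline b,-\overline a)^\top$ (applied pointwise). *)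

(* Defs.v *)
From HB Require Import structures.
From mathcomp Require Import all_boot all_order all_algebra.
From mathcomp Require Import all_classical all_reals all_analysis.
From mathcomp Require Import complex.
Set Implicit Arguments. Unset Strict Implicit. Unset Printing Implicit Defensive.
Import Order.TTheory GRing.Theory Num.Theory.
Import numFieldNormedType.Exports.
Local Open Scope classical_set_scope.
Local Open Scope ring_scope.

Section Dirac.
Variable R : realType.
Local Notation mu := (@lebesgue_measure R).
Local Notation C := R[i].
Local Notation ReC := (@complex.Re R).
Local Notation ImC := (@complex.Im R).

Definition cabs2 (w : C) : R := ReC w ^+ 2 + ImC w ^+ 2.
Definition vnorm (F : R -> C * C) (x : R) : R :=
  Num.sqrt (cabs2 (F x).1 + cabs2 (F x).2).

Definition loc_integrable (f : R -> R) :=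
  forall a b : R, mu.-integrable `[a, b] (EFin \o f).
Definition cLloc1 (q : R -> C) :=
  loc_integrable (ReC \o q) /\ loc_integrable (ImC \o q).

Definition abs_cont_on (a b : R) (f : R -> R) :=
  forall e : R, 0 < e -> exists2 d : R, 0 < d &
    forall (n : nat) (u v : 'I_n -> R),
      (forall i, a <= u i /\ u i <= v i /\ v i <= b) ->
      (forall i j : 'I_n, (i < j)%N -> v i <= u j) ->
      \sum_(i < n) (v i - u i) < d ->
      \sum_(i < n) `|f (v i) - f (u i)| < e.
Definition ACloc (f : R -> R) := forall a b : R, abs_cont_on a b f.
Definition cACloc (f : R -> C) := ACloc (ReC \o f) /\ ACloc (ImC \o f).
Definition vACloc (F : R -> C * C) :=
  cACloc (fun x => (F x).1) /\ cACloc (fun x => (F x).2).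

Definition cderivable (f : R -> C) (x : R) :=
  derivable (ReC \o f) x 1 /\ derivable (ImC \o f) x 1.
Definition cder (f : R -> C) (x : R) : C :=
  (derive1 (ReC \o f) x +i* derive1 (ImC \o f) x)%C.
Definition vderivable (F : R -> C * C) (x : R) :=
  cderivable (fun y => (F y).1) x /\ cderivable (fun y => (F y).2) x.

(* the differential expression M(q) = i [[d/dx, -q], [-conj q, -d/dx]] *)
Definition Mq (q : R -> C) (F : R -> C * C) (x : R) : C * C :=
  ('i%C * (cder (fun y => (F y).1) x - q x * (F x).2),
   'i%C * (- conjc (q x) * (F x).1 - cder (fun y => (F y).2) x)).

Definition wave (q : R -> C) (z : C) (Psi : R -> C * C) :=
  vACloc Psi /\ (exists x, Psi x <> (0, 0)) /\
  {ae mu, forall x, vderivable Psi x /\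
     cder (fun y => (Psi y).1) x = - 'i%C * z * (Psi x).1 + q x * (Psi x).2 /\
     cder (fun y => (Psi y).2) x = 'i%C * z * (Psi x).2 - conjc (q x) * (Psi x).1}.

Definition cmeas (A : set R) (f : R -> C) :=
  measurable_fun A (ReC \o f) /\ measurable_fun A (ImC \o f).
Definition L2on (A : set R) (F : R -> C * C) :=
  cmeas A (fun x => (F x).1) /\ cmeas A (fun x => (F x).2) /\
  (\int[mu]_(x in A) ((vnorm F x) ^+ 2)%:E < +oo)%E.
Definition rL2on (A : set R) (g : R -> R) :=
  measurable_fun A g /\ (\int[mu]_(x in A) ((g x) ^+ 2)%:E < +oo)%E.
Definition L2norm2 (F : R -> C * C) : \bar R :=
  (\int[mu]_(x in [set: R]) ((vnorm F x) ^+ 2)%:E)%E.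

(* graph of the maximal operator D(q): F in dom D(q) and D(q)F = H (in L^2) *)
Definition Dgraph (q : R -> C) (F H : R -> C * C) :=
  L2on [set: R] F /\ vACloc F /\ L2on [set: R] H /\
  {ae mu, forall x, vderivable F x /\ H x = Mq q F x}.

(* z in the resolvent set of D(q): D(q) - z is a bijection of dom D(q) onto
   L^2(R)^2 (equality in L^2 meaning a.e. equality) with bounded inverse *)
Definition resolvent (q : R -> C) (z : C) :=
  (forall G, L2on [set: R] G -> exists F H, Dgraph q F H /\
      {ae mu, forall x, G x = ((H x).1 - z * (F x).1, (H x).2 - z * (F x).2)}) /\
  (exists c : R, forall F H, Dgraph q F H ->
      (L2norm2 F <= c%:E *
        L2norm2 (fun x => ((H x).1 - z * (F x).1, (H x).2 - z * (F x).2)%R))%E).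

Definition Kop (F : R -> C * C) (x : R) : C * C :=
  (conjc (F x).2, - conjc (F x).1).

Definition weyl_pair (q : R -> C) (z : C) (Pm Pp : R -> C * C) :=
  wave q z Pm /\ wave q z Pp /\
  (forall a b : C, (forall x, a * (Pm x).1 + b * (Pp x).1 = 0 /\
                              a * (Pm x).2 + b * (Pp x).2 = 0) -> a = 0 /\ b = 0) /\
  (forall Phi, wave q z Phi -> (forall r : R, L2on `]-oo, r] Phi) ->
     exists c : C, forall x, Phi x = (c * (Pm x).1, c * (Pm x).2)) /\
  (forall Phi, wave q z Phi -> (forall r : R, L2on `[r, +oo[ Phi) ->
     exists c : C, forall x, Phi x = (c * (Pp x).1, c * (Pp x).2)) /\
  (forall r : R, L2on `]-oo, r] Pm /\ L2on `[r, +oo[ Pp /\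
     rL2on `[r, +oo[ (fun x => (vnorm Pm x)^-1) /\
     rL2on `]-oo, r] (fun x => (vnorm Pp x)^-1)) /\
  vnorm Pp x @[x --> +oo] --> (0 : R) /\
  (vnorm Pp x)^-1 @[x --> -oo] --> (0 : R) /\
  vnorm Pm x @[x --> -oo] --> (0 : R) /\
  (vnorm Pm x)^-1 @[x --> +oo] --> (0 : R) /\
  (exists M : R, forall r : R,
     (\int[mu]_(x in `]-oo, r]) ((vnorm Pm x) ^+ 2)%:E *
      \int[mu]_(x in `[r, +oo[) ((vnorm Pp x) ^+ 2)%:E <= M%:E)%E).

End Dirac.

(* Main.v *)
(* The quantity |F|^2 = |F_1|^2 + |F_2|^2 of a z-wave function satisfies |(|F|^2)'| <= 2 |Im z| |F|^2, because the potential is skew-adjoint and cancels; and the wronskian of two z-wave functions is constant. Two solutions that are square integrable at the same end have wronskian 0, since |W|^2 <= |Phi|^2 |Psi|^2, so each end carries at most one square integrable solution up to multiples.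
   To produce them, solve (D(q) - z) F = G where G = (conj Phi_2, conj Phi_1) on [s, r] and G = 0 elsewhere: left and right of [s, r] the function F is a z-wave function, square integrable at the corresponding end, and the wronskian of Phi and F increases by i int_s^r |Phi|^2 across [s, r]. As this jump is not 0, solutions exist at both ends. The choice Phi = Psi_- makes F a multiple of Psi_+ on [r, oo) whose factor is known from the jump, so that the bound on the resolvent is the asserted supremum bound.
   Decay at the square integrable end follows from |F(x)|^2 <= C int_x^(x+1) |F|^2, and growth at the other end from |Psi_-|^-1 <= |Psi_+| / |W|. *)
Require Import Defs.
From HB Require Import structures.
From mathcomp Require Import all_boot all_order all_algebra.
From mathcomp Require Import all_classical all_reals all_analysis.
From mathcomp Require Import measurable_realfun complex ring lra.
Set Implicit Arguments. Unset Strict Implicit. Unset Printing Implicit Defensive.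
Import Order.TTheory GRing.Theory Num.Theory.
Import numFieldNormedType.Exports.
Local Open Scope classical_set_scope.
Local Open Scope ring_scope.

Local Notation "\iint_ A f" := (\int[lebesgue_measure]_(x in A) (f x)%:E)%E
  (at level 36, A at level 0, f at level 0).

(** A single real-variable fact carries the analysis: an absolutely continuous function whose
    derivative is nonnegative almost everywhere does not decrease. Compared with exponential weights
    it bounds the Picard iterates and the growth of |F|^2; compared with a primitive it evaluates
    the jump of the wronskian. As q is only locally integrable, the Cauchy problem is solved in the
    sense of Carathéodory, globally on the line; this is what extends the two pieces of F beyond
    [s, r] to z-wave functions. A nonzero jump alone shows only that one of the two pieces is
    nonzero. Both ends are reached by feeding the piece obtained at one end back in as Phi: two
    pieces at the same end have wronskian 0, so the second jump must come from the other end. Linear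
    independence rests on injectivity: proportional Psi_- and Psi_+ would give a square integrable
    eigenfunction for z. *)

#[local] Instance ae_lebesgue_filter (R : realType) :
    Filter (almost_everywhere (@lebesgue_measure R)) :=
  ae_filter_ringOfSetsType (@lebesgue_measure R).

(** * Absolutely continuous functions *)

Section AbsoluteContinuity.
Context {R : realType}.
Local Notation mu := (@lebesgue_measure R).
Implicit Types (f g h : R -> R) (a b c l e x y : R).

(** Real induction. The supremum of the good points is approached by a good x, and the step carries
    P across it to a y further right, unless b is reached. The step relates points on either side of
    c because a derivative at c controls increments only across c. *)
Lemma segment_induction (P : R -> Prop) a b : a <= b -> P a ->
  (forall c, a <= c <= b -> exists2 r, 0 < r & forall x y,
    a <= x -> x <= c -> c <= y -> y <= b -> c - r < x -> y < c + r ->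
    P x -> P y) ->
  P b.
Proof.
move=> ab Pa step; pose S := [set x | a <= x <= b /\ P x].
have Sa : S a by split=> //; rewrite lexx.
have ubS : ubound S b by move=> x [/andP[]].
have supS : has_sup S by split; [exists a | exists b].
have ac : a <= sup S by apply: ub_le_sup => //; exists b.
have cb : sup S <= b by apply: ge_sup => //; exists a.
have [|r r0 hr] := step (sup S); first by rewrite ac.
have [x [/andP[ax xb] Px] cx] := sup_adherent r0 supS.
have xc : x <= sup S by apply: ub_le_sup => //; [exists b | split; rewrite ?ax].
pose y := Num.min b (sup S + r / 2).
have cy : sup S <= y by rewrite le_min cb lerDl divr_ge0// ltW.
have Py : P y.
  apply: (hr x) => //; first by rewrite ge_min lexx.
  by rewrite gt_min ltrD2l; apply/orP; right; lra.
have yS : y <= sup S.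
  apply: ub_le_sup; first by exists b.
  by split=> //; rewrite (le_trans ac cy)//= ge_min lexx.
suff <- : y = b by [].
move: yS; rewrite /y; case: (leP b) => // _.
by rewrite gerDl leNgt divr_gt0.
Qed.

(** The increment is split at c and each half is estimated by a difference quotient at c, so x and y
    may approach c at unrelated rates. *)
Lemma is_derive_ge0_near f c l e : is_derive c 1 f l -> 0 <= l -> 0 < e ->
  exists2 r, 0 < r & forall x y, x <= c -> c <= y -> c - r < x -> y < c + r ->
    f x - f y <= e * (y - x).
Proof.
move=> fl l0 e0.
have df : derivable f c 1 by [].
have /cvgrPdist_lt /(_ _ e0) : h^-1 *: (f (h *: 1%R + c) - f c) @[h --> 0^'] --> l.
  by rewrite -(@derive_val _ _ _ _ _ _ _ fl); exact: df.
move=> [r /= r0 hr]; exists r => // x y xc cy rx ry.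
have key t : c - r < t -> t < c + r -> t != c -> - e < (f t - f c) / (t - c).
  move=> t1 t2 tc.
  have := hr (t - c); rewrite /ball_/= sub0r normrN => /(_ _ _).
  rewrite ltr_norml ltrBrDl ltrBlDl => /(_ _ _)/wrap[].
    by apply/andP; split; lra.
  by rewrite subr_eq0.
  rewrite /GRing.scale/= mulr1 subrK => H.
  have {H} : l - (t - c)^-1 * (f t - f c) < e.
    by apply: (le_lt_trans (ler_norm _) H).
  by rewrite mulrC; lra.
have left : f x - f c <= e * (c - x).
  have [->|xnc] := eqVneq x c; first by rewrite !subrr mulr0.
  have xc' : x < c by rewrite lt_neqAle xnc.
  have xr : x < c + r by lra.
  by have := key x rx xr xnc; rewrite ltr_ndivlMr ?subr_lt0//; lra.
have right : f c - f y <= e * (y - c).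
  have [->|ync] := eqVneq y c; first by rewrite !subrr mulr0.
  have cy' : c < y by rewrite lt_neqAle eq_sym ync.
  have yr : c - r < y by lra.
  by have := key y yr ry ync; rewrite ltr_pdivlMr ?subr_gt0//; lra.
lra.
Qed.

(** A list in place of a family over ['I_n] lets the induction below append one interval at a
    time. *)
Lemma abs_cont_on_seq a b f e : abs_cont_on a b f -> 0 < e ->
  exists2 d, 0 < d & forall s : seq (R * R),
    all (fun p => [&& a <= p.1, p.1 <= p.2 & p.2 <= b]) s ->
    pairwise (fun p p' : R * R => p.2 <= p'.1) s ->
    \sum_(p <- s) (p.2 - p.1) < d ->
    \sum_(p <- s) `|f p.2 - f p.1| < e.
Proof.
move=> acf /acf[d d0 hd]; exists d => // s /allP sab /(pairwiseP (0, 0)) sP sd.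
have := hd (size s) (fun i => (nth (0, 0) s i).1) (fun i => (nth (0, 0) s i).2).
rewrite !(big_nth (0, 0)) !big_mkord in sd *; apply => //.
- by move=> i; have /and3P[] := sab _ (mem_nth (0, 0) (ltn_ord i)).
- by move=> i j ij; apply: sP => //; rewrite inE.
Qed.

(* Off a null set the derivative controls the increments of f on small intervals; the null set lies in an open set U of small measure, where absolute continuity controls them. The list s in P collects the intervals inside U, and mu (U `&` `[a, x]) keeps account of their total length. *)
Lemma abs_cont_ge0_derive f a b : a <= b -> abs_cont_on a b f ->
  {ae mu, forall x, a < x < b -> exists2 l, is_derive x 1 f l & 0 <= l} ->
  f a <= f b.
Proof.
move=> ab acf [N [mN N0 hN]]; rewrite -subr_le0.
suff H e : 0 < e -> f a - f b <= e * (b - a + 1).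
  apply/ler_addgt0Pr => e e0; rewrite add0r.
  have c0 : 0 < b - a + 1 by rewrite ltr_wpDl// subr_ge0.
  by rewrite (le_trans (H (e / (b - a + 1)) _)) ?divr_gt0// divfK// gt_eqF.
move=> e0; have [d d0 hd] := abs_cont_on_seq acf e0.
(* The end points join the null set, since the derivative is given only inside ]a, b[; every c
   outside [U] is then interior. *)
have mab : measurable [set a; b] by apply: measurableU; exact: measurable_set1.
have mN' : measurable (N `|` [set a; b]) by exact: measurableU.
have N'0 : mu (N `|` [set a; b]) = 0%E.
  apply/negligibleP => //; apply: negligibleU; first exact/negligibleP.
  have n1 c : mu.-negligible [set c].
    by apply/negligibleP; [exact: measurable_set1 | exact: lebesgue_measure_set1].
  exact: (negligibleU (n1 a) (n1 b)).
have N'f : (mu (N `|` [set a; b]) < +oo)%E by rewrite N'0.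
have [U [oU NU Ud]] := lebesgue_regularity_outer mN' N'f d0.
have mU : measurable U := open_measurable oU.
have {}Ud : (mu U < d%:E)%E.
  apply: le_lt_trans Ud; rewrite -[leRHS]adde0 -N'0.
  rewrite -measureU//; [ | exact: measurableD | by rewrite setDKI].
  apply: le_measure; rewrite ?inE//; first by apply: measurableU => //; exact: measurableD.
  by move=> t Ut; have [|] := pselect ((N `|` [set a; b]) t); [right | left].
pose P x := exists2 s : seq (R * R),
  [/\ all (fun p => [&& a <= p.1, p.1 <= p.2 & p.2 <= x]) s,
    pairwise (fun p p' : R * R => p.2 <= p'.1) s &
    ((\sum_(p <- s) (p.2 - p.1))%:E <= mu (U `&` `[a, x]))%E] &
  f a - f x <= e * (x - a) + \sum_(p <- s) `|f p.2 - f p.1|.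
suff [s [s1 s2 s3] s4] : P b.
  suff : \sum_(p <- s) `|f p.2 - f p.1| < e by move: s4; lra.
  rewrite hd//.
  rewrite -lte_fin (le_lt_trans s3)// (le_lt_trans _ Ud)//.
  by apply: le_measure; rewrite ?inE//; exact: measurableI.
apply: (segment_induction ab).
  exists [::]; first by split; rewrite // big_nil measure_ge0.
  by rewrite big_nil !subrr mulr0 addr0.
move=> c /andP[ac cb]; have [Uc|Uc] := pselect (U c).
- have [r /= r0 hr] : nbhs c U by exact: open_nbhs_nbhs.
  exists r => // x y ax xc cy yb rx yr [s [s1 s2 s3] s4].
  have xy := le_trans xc cy.
  (* The half-open interval keeps the new piece disjoint from [a, x], so that the measures add. *)
  have Uxy : U `&` `]x, y] = `]x, y]%classic.
    apply/seteqP; split=> [t []//|t txy]; split=> //; apply: hr.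
    move: txy; rewrite /= in_itv/= => /andP[xt ty].
    by rewrite /ball_/= ltr_norml; lra.
  have muxy : mu `]x, y] = (y - x)%:E.
    rewrite lebesgue_measure_itv/= lte_fin; move: xy.
    by rewrite le_eqVlt => /predU1P[->|->//]; rewrite ltxx subrr.
  exists (rcons s (x, y)).
    split.
    + rewrite all_rcons /= ax xy lexx /=; apply: sub_all s1 => p /and3P[-> ->] /=.
      by move=> /le_trans; exact.
    + rewrite pairwise_rcons s2 andbT; apply: sub_all s1 => p /and3P[_ _] /=.
      by [].
    + rewrite big_rcons/= EFinD.
      have -> : U `&` `[a, y] = (U `&` `[a, x]) `|` (U `&` `]x, y]).
        rewrite -setIUr; congr (_ `&` _).
        by rewrite -itv_bndbnd_setU// bnd_simp.
      rewrite measureU; last 3 first.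
      * exact: measurableI.
      * exact: measurableI.
      * rewrite setIACA setIid [X in _ `&` X](_ : _ = set0) ?setI0//.
        apply/seteqP; split=> // t /=; rewrite !in_itv/= => -[/andP[_ tx] /andP[xt _]].
        by move: (lt_le_trans xt tx); rewrite ltxx.
      rewrite Uxy; apply: leeD s3 _.
      by rewrite -muxy; exact: lexx.
  rewrite big_rcons/=.
  have : f x - f y <= `|f y - f x| by rewrite distrC ler_norm.
  move: s4; nra.
- have ac' : a < c by rewrite lt_neqAle ac andbT; apply/eqP => ac'; apply: Uc; apply: NU; right; left.
  have cb' : c < b by rewrite lt_neqAle cb andbT; apply/eqP => bc'; apply: Uc; apply: NU; right; right.
  have [l fl l0] : exists2 l, is_derive c 1 f l & 0 <= l.
    apply: contrapT => nl; apply: Uc; apply: NU; left; apply: hN => /= H.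
    by apply: nl; apply: H; rewrite ac' cb'.
  have [r r0 hr] := is_derive_ge0_near fl l0 e0.
  exists r => // x y ax xc cy yb rx yr [s [s1 s2 s3] s4].
  have xy := le_trans xc cy.
  exists s; first split=> //.
  + by apply: sub_all s1 => p /and3P[-> ->] /= /le_trans; exact.
  + apply: (le_trans s3); apply: le_measure; rewrite ?inE//; try exact: measurableI.
    by apply: setIS; apply: subset_itvl; rewrite bnd_simp.
  + have := hr _ _ xc cy rx yr; move: s4; nra.
Qed.

(** Carrying the derivative as an explicit function, determined only up to null sets ([acd_ae]),
    turns differential equations into calculations with the rules below. *)
Definition acd f f' := ACloc f /\ {ae mu, forall x, is_derive x 1 f (f' x)}.

(** Sums, products and exponentials all get absolute continuity from this criterion; K may depend on
    [a, b], since the factors are bounded only locally. *)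
Lemma ACloc_lip f g h :
  (forall a b, exists K, forall u v, a <= u -> u <= v -> v <= b ->
    `|h v - h u| <= K * (`|f v - f u| + `|g v - g u|)) ->
  ACloc f -> ACloc g -> ACloc h.
Proof.
move=> hK acf acg a b e e0; have [K HK] := hK a b.
(* K may be 0 or negative; the maximum with 1 can be divided by. *)
pose k := Num.max K 1.
have k0 : 0 < k by rewrite lt_max ltr01 orbT.
have e1 : 0 < e / k / 2 by rewrite !divr_gt0.
have [d1 d10 h1] := acf a b _ e1; have [d2 d20 h2] := acg a b _ e1.
exists (Num.min d1 d2); first by rewrite lt_min d10.
move=> n u v uv dis; rewrite lt_min => /andP[s1 s2].
apply: (@le_lt_trans _ _ (k * (\sum_(i < n) `|f (v i) - f (u i)| + \sum_(i < n) `|g (v i) - g (u i)|))).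
  rewrite -big_split mulr_sumr; apply: ler_sum => i _ /=.
  have [au [uvi vb]] := uv i; apply: (le_trans (HK _ _ au uvi vb)).
  by apply: ler_wpM2r; rewrite ?addr_ge0// le_max lexx.
rewrite mulrC -ltr_pdivlMr//.
rewrite [ltRHS](_ : _ = e / k / 2 + e / k / 2); last by field; rewrite gt_eqF.
by rewrite ltrD ?h1 ?h2.
Qed.

Lemma ACloc_continuous f : ACloc f -> continuous f.
Proof.
move=> acf x; apply/cvgrPdist_lt => e e0.
have [d d0 hd] := acf (x - 1) (x + 1) e e0.
exists (Num.min d 1); first by rewrite /= lt_min d0 ltr01.
move=> y; rewrite /ball_/= lt_min => /andP[xyd xy1].
have key u v : x - 1 <= u -> u <= v -> v <= x + 1 -> v - u < d -> `|f v - f u| < e.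
  move=> h1 h2 h3 h4.
  have := hd 1%N (fun=> u) (fun=> v); rewrite !big_ord1; apply => //.
  by move=> i j; rewrite !ord1.
have /andP[p1 p2] : - d < x - y < d by rewrite -ltr_norml.
have /andP[p3 p4] : - 1 < x - y < 1 by rewrite -ltr_norml.
have [xy|/ltW yx] := leP x y; last by apply: key; lra.
by rewrite distrC; apply: key; lra.
Qed.

Lemma continuous_bounded f a b : continuous f ->
  exists M, 0 <= M /\ forall x, a <= x <= b -> `|f x| <= M.
Proof.
move=> cf; have [ab|ba] := leP a b; last first.
  by exists 0; split=> // x /andP[ax xb]; move: (lt_le_trans ba (le_trans ax xb)); rewrite ltxx.
have cnf : {within `[a, b], continuous (fun x => `|f x|)}.
  apply: continuous_subspaceT => x.
  by apply: (@continuous_comp _ _ _ f (fun y => `|y|)); [exact: cf | exact: norm_continuous].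
have [c _ hc] := EVT_max ab cnf.
by exists `|f c|; split=> // x xab; apply: hc; rewrite in_itv.
Qed.

Lemma acd_continuous f f' : acd f f' -> continuous f.
Proof. by move=> [/ACloc_continuous]. Qed.

Lemma acd_cst c : acd (fun=> c) (fun=> 0).
Proof.
split; last by apply: aeW => x; exact: is_derive_cst.
move=> a b e e0; exists 1 => // n u v _ _ _.
by rewrite big1// => i _; rewrite subrr normr0.
Qed.

Lemma acd_ae f f' g' : acd f f' -> {ae mu, forall x, f' x = g' x} -> acd f g'.
Proof.
move=> [acf df] fg; split=> //; apply: filterS2 df fg => x df <-; exact: df.
Qed.

Lemma acdD f f' g g' : acd f f' -> acd g g' ->
  acd (fun x => f x + g x) (fun x => f' x + g' x).
Proof.
move=> [acf df] [acg dg]; split.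
  apply: ACloc_lip acf acg => a b; exists 1 => u v _ _ _.
  rewrite mul1r (le_trans _ (ler_normD _ _))//.
  by rewrite [X in `|X| <= _](_ : _ = f v - f u + (g v - g u)) //; ring.
by apply: filterS2 df dg => x dfx dgx; exact: is_deriveD.
Qed.

Lemma acdM f f' g g' : acd f f' -> acd g g' ->
  acd (fun x => f x * g x) (fun x => f' x * g x + f x * g' x).
Proof.
move=> fd gd; have [acf df] := fd; have [acg dg] := gd; split.
  apply: ACloc_lip acf acg => a b.
  have [M [M0 hM]] := continuous_bounded a b (acd_continuous fd).
  have [K [K0 hK]] := continuous_bounded a b (acd_continuous gd).
  exists (M + K) => u v au uv vb.
  have -> : f v * g v - f u * g u = f v * (g v - g u) + g u * (f v - f u) by ring.
  apply: (le_trans (ler_normD _ _)); rewrite !normrM.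
  have := hM v; rewrite vb (le_trans au uv) => /(_ isT) h1.
  have := hK u; rewrite au (le_trans uv vb) => /(_ isT) h2.
  have := normr_ge0 (g v - g u); have := normr_ge0 (f v - f u).
  move: h1 h2; set A := `|f v|; set B := `|g u|; nra.
apply: filterS2 df dg => x dfx dgx.
by apply: is_derive_eq; rewrite /GRing.scale/=; ring.
Qed.

Lemma acdZ c f f' : acd f f' -> acd (fun x => c * f x) (fun x => c * f' x).
Proof.
move=> fd; apply: acd_ae (acdM (acd_cst c) fd) _.
by apply: aeW => x; rewrite mul0r add0r.
Qed.

Lemma acdN f f' : acd f f' -> acd (fun x => - f x) (fun x => - f' x).
Proof.
move=> /(acdZ (-1)); under eq_fun do rewrite mulN1r.
by under [X in acd _ X]eq_fun do rewrite mulN1r.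
Qed.

Lemma acdB f f' g g' : acd f f' -> acd g g' ->
  acd (fun x => f x - g x) (fun x => f' x - g' x).
Proof. by move=> fd gd; apply: acdD fd (acdN gd). Qed.

Lemma acd_id : acd (fun x => x) (fun=> 1).
Proof.
split; last by apply: aeW => x; exact: is_derive_id.
move=> a b e e0; exists e => // n u v uv _; apply: le_lt_trans.
by apply: ler_sum => i _; rewrite ger0_norm// subr_ge0; have [_ []] := uv i.
Qed.

Lemma acd_expR f f' : acd f f' ->
  acd (fun x => expR (f x)) (fun x => f' x * expR (f x)).
Proof.
move=> fd; have [acf df] := fd; split.
  apply: (ACloc_lip _ acf acf) => a b.
  have [M [M0 hM]] := continuous_bounded a b (acd_continuous fd).
  exists (expR M).
  suff H s t : s <= t -> `|t| <= M -> `|expR t - expR s| <= expR M * `|t - s|.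
    move=> u v au uv vb.
    have := hM v; rewrite vb (le_trans au uv) => /(_ isT) h1.
    have := hM u; rewrite au (le_trans uv vb) => /(_ isT) h2.
    apply: (@le_trans _ _ (expR M * `|f v - f u|)).
      have [st|/ltW st] := leP (f u) (f v); first exact: H.
      by rewrite distrC [X in _ * X]distrC; exact: H.
    by apply: ler_wpM2l; rewrite ?expR_ge0// lerDl.
  move=> st tM; have est : expR s <= expR t by rewrite ler_expR.
  rewrite ger0_norm; last by rewrite subr_ge0.
  rewrite ger0_norm ?subr_ge0//.
  (* Multiplied by [expR t], this is the tangent bound e^t - e^s <= e^t (t - s), whence the
     Lipschitz constant [expR M]. *)
  have h := expR_ge1Dx (s - t).
  have -> : expR s = expR t * expR (s - t) by rewrite -expRD addrC subrK.
  have h2 : expR t <= expR M by rewrite ler_expR (le_trans (ler_norm _)).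
  have h3 := expR_gt0 t.
  nra.
apply: filterS df => x dfx.
rewrite mulrC.
exact: (@is_derive1_comp R expR f x _ _ (is_derive_expR (f x)) dfx).
Qed.

(** Together with [acd_eq] this takes the place of the fundamental theorem of calculus: a derivative
    is integrated by comparison with a function whose derivative is known. *)
Lemma acd_le f f' g g' a b : a <= b -> acd f f' -> acd g g' ->
  {ae mu, forall x, a < x < b -> f' x <= g' x} -> f b - f a <= g b - g a.
Proof.
move=> ab fd gd fg.
have [ac d] := acdB gd fd.
have := abs_cont_ge0_derive ab (ac a b).
suff: {ae mu, forall x, a < x < b -> exists2 l, is_derive x 1 (fun x => g x - f x) l & 0 <= l}.
  by move=> H /(_ H); lra.
apply: filterS2 d fg => x d fg xab; exists (g' x - f' x) => //.
by rewrite subr_ge0; exact: fg.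
Qed.

Lemma acd_eq f f' g g' a b : a <= b -> acd f f' -> acd g g' ->
  {ae mu, forall x, a < x < b -> f' x = g' x} -> f b - f a = g b - g a.
Proof.
move=> ab fd gd fg; apply/eqP; rewrite eq_le.
by rewrite (acd_le ab fd gd) ?(acd_le ab gd fd)//; apply: filterS fg => x H /H ->.
Qed.

Lemma acd0_cst f : acd f (fun=> 0) -> forall x y, f x = f y.
Proof.
move=> fd; suff H x y : x <= y -> f x = f y.
  by move=> x y; have [|/ltW] := leP x y => /H.
move=> xy; have := acd_eq xy fd (acd_cst 0).
by rewrite subrr => H; apply/esym/eqP; rewrite -subr_eq0 H//; apply: aeW.
Qed.

End AbsoluteContinuity.

(** * Primitives of locally integrable functions *)

Section Primitive.
Context {R : realType}.
Local Notation mu := (@lebesgue_measure R).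
Implicit Types (f g h : R -> R) (a b c e x y : R).

Lemma loc_integrable_measurable f : loc_integrable f -> measurable_fun setT f.
Proof.
move=> lf.
have -> : [set: R] = \bigcup_(n : nat) `[- (n%:R : R), n%:R]%classic.
  apply/esym/seteqP; split=> // x _; exists (Num.bound `|x|) => //=.
  by rewrite in_itv/= -ler_norml ltW// archi_boundP.
apply/measurable_fun_bigcup => [n|n]; first exact: measurable_itv.
by have /integrableP[/measurable_EFinP] := lf (- n%:R) n%:R.
Qed.

Lemma loc_integrable_continuous f : continuous f -> loc_integrable f.
Proof.
move=> cf a b; apply: continuous_compact_integrable; first exact: segment_compact.
exact: continuous_subspaceT.
Qed.

Lemma loc_integrable_norm f : loc_integrable f -> loc_integrable (fun x => `|f x|).
Proof. by move=> lf a b; apply: integrable_norm. Qed.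

Lemma loc_integrableD f g : loc_integrable f -> loc_integrable g ->
  loc_integrable (fun x => f x + g x).
Proof.
move=> lf lg a b; rewrite (_ : _ \o _ = (EFin \o f) \+ (EFin \o g))%E//.
exact: integrableD.
Qed.

Lemma loc_integrable0 : loc_integrable (fun=> 0 : R).
Proof. by apply: loc_integrable_continuous => x; exact: cst_continuous. Qed.

Lemma loc_integrable_sum n (f : 'I_n -> R -> R) :
  (forall i, loc_integrable (f i)) -> loc_integrable (fun x => \sum_(i < n) f i x).
Proof.
elim: n f => [|n IH] f lf.
  by under eq_fun do rewrite big_ord0; exact: loc_integrable0.
by under eq_fun do rewrite big_ord_recl; apply: loc_integrableD => //; exact: IH.
Qed.

Lemma loc_integrableM f g : loc_integrable f -> continuous g ->
  loc_integrable (fun x => f x * g x).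
Proof.
move=> lf cg a b; rewrite (_ : _ \o _ = (EFin \o f) \* (EFin \o g))%E//.
have mg : measurable_fun `[a, b] g.
  by apply: measurable_funTS; exact: continuous_measurable_fun.
apply: integrableMl => //.
have [M [M0 hM]] := continuous_bounded a b cg.
exists M; split; first exact: num_real.
by move=> N MN x /=; rewrite in_itv/= => /hM /le_trans; apply; exact: ltW.
Qed.

Lemma loc_integrable_le f g : measurable_fun setT f ->
  (forall x, `|f x| <= g x) -> loc_integrable g -> loc_integrable f.
Proof.
move=> mf fg lg a b; apply: (le_integrable _ _ _ (lg a b)) => //.
  by apply/measurable_EFinP; apply: measurable_funTS.
by move=> x _ /=; rewrite lee_fin (le_trans (fg x))// ler_norm.
Qed.

(** One of the two integrals is always over an empty interval or a point, so this is the oriented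
    integral from c to x. *)
Definition prim c f x : R :=
  \int[mu]_(t in `[c, x]) f t - \int[mu]_(t in `[x, c]) f t.

Lemma Rintegral_itv_le f x y : y <= x -> \int[mu]_(t in `[x, y]) f t = 0.
Proof.
rewrite le_eqVlt => /predU1P[->|yx]; first by rewrite set_itv1 Rintegral_set1.
by rewrite set_itv_ge ?Rintegral_set0// bnd_simp -ltNge.
Qed.

Lemma Rintegral_chasles f x y z : loc_integrable f -> x <= y -> y <= z ->
  \int[mu]_(t in `[x, z]) f t =
  \int[mu]_(t in `[x, y]) f t + \int[mu]_(t in `[y, z]) f t.
Proof.
move=> lf xy yz.
have := @Rintegral_itvB R f (BLeft x) (BRight z) y (lf x z).
rewrite !bnd_simp => /(_ xy yz); rewrite Rintegral_itv_obnd_cbnd.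
  by move=> <-; rewrite subrKC.
apply: (integrableS _ _ _ (lf x z)) => //; apply: subset_itvr.
by rewrite bnd_simp.
Qed.

Lemma primB c f x y : loc_integrable f -> x <= y ->
  prim c f y - prim c f x = \int[mu]_(t in `[x, y]) f t.
Proof.
move=> lf xy; rewrite /prim.
have [x0|/ltW x0] := leP c x; have [y0|/ltW y0] := leP c y.
- rewrite (Rintegral_itv_le f x0) (Rintegral_itv_le f y0).
  by rewrite (Rintegral_chasles lf x0 xy); ring.
- have -> : x = c by lra.
  have -> : y = c by lra.
  by rewrite !subrr Rintegral_itv_le.
- rewrite (Rintegral_itv_le f x0) (Rintegral_itv_le f y0).
  by rewrite (Rintegral_chasles lf x0 y0); ring.
- rewrite (Rintegral_itv_le f x0) (Rintegral_itv_le f y0).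
  by rewrite (Rintegral_chasles lf xy y0); ring.
Qed.

Lemma prim_base c f : prim c f c = 0.
Proof. by rewrite /prim subrr. Qed.

Lemma prim_derive c f : loc_integrable f ->
  {ae mu, forall x, is_derive x 1 (prim c f) (f x)}.
Proof.
move=> lf; have lif : locally_integrable [set: R] f.
  split; [exact: loc_integrable_measurable | exact: openT |].
  move=> K _ cK; have [M [_ hM]] := compact_bounded cK.
  have KM : K `<=` `[- (M + 1), M + 1].
    by move=> x Kx; rewrite /= in_itv/= -ler_norml; apply: hM => //; lra.
  have mK : measurable K := compact_measurable cK.
  have /integrableP[_ //] : mu.-integrable K (EFin \o f).
  by apply: (integrableS _ _ _ (lf (- (M + 1)) (M + 1))) => //; exact: measurable_itv.
have := lebesgue_differentiation lif; apply: filterS => x fx.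
have x1 : x < x + 1 by rewrite ltrDl.
(* The differentiation theorem is applied with a base point to the left of x; moving it from c to x
   - 1 changes [prim] by a constant. *)
have [dF F'] : derivable (fun y => \int[mu]_(t in `[x - 1, y]) f t) x 1 /\
    derive1 (fun y => \int[mu]_(t in `[x - 1, y]) f t) x = f x.
  apply: (@FTC1_lebesgue_pt R f (BLeft (x - 1)) x (x + 1)) => //.
  by rewrite (@lte_fin R); lra.
apply: (@near_eq_is_derive _ _ _
  (fun y => prim c f (x - 1) + \int[mu]_(t in `[x - 1, y]) f t)).
  exists 1 => //= y; rewrite /ball_/= ltr_norml => xy.
  by rewrite -(primB c)//; [rewrite subrKC | lra].
rewrite -F' derive1E -[X in is_derive _ _ _ X]add0r.
by apply: (is_deriveD (is_derive_cst _ _ _)); exact: derivableP.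
Qed.

Lemma prim_ACloc c f : loc_integrable f -> ACloc (prim c f).
Proof.
move=> lf a b e e0; have [d [d0 hd]] : exists d, 0 < d /\ forall A, measurable A ->
    (mu A < d%:E)%E -> \int[mu]_(x in A) `|(f \_ `[a, b]) x| < e.
  apply: integral_normr_continuous => //.
  by rewrite -restrict_EFin; apply/integrable_restrict => //=; rewrite setTI.
exists d => // n u v uv dis suv.
(* Consecutive intervals may share an end point; half-open ones are disjoint, so their measures and
   integrals add. *)
pose F i := `]u i, v i]%classic.
have mF i : measurable (F i) by exact: measurable_itv.
have muF i : mu (F i) = (v i - u i)%:E.
  rewrite /F lebesgue_measure_itv/= lte_fin.
  have [_ [+ _]] := uv i; rewrite le_eqVlt => /predU1P[->|->//].
  by rewrite ltxx subrr.
have tF : trivIset setT F.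
  apply/trivIsetP => i j _ _; rewrite neq_ltn => ij; apply/seteqP; split=> // x [].
  rewrite /F/= !in_itv/= => /andP[ui vi] /andP[uj vj].
  move: ij => /orP[] /dis H.
    by move: (lt_le_trans (le_lt_trans (le_trans vi H) uj) (lexx x)); rewrite ltxx.
  by move: (le_lt_trans (le_trans vj H) ui); rewrite ltxx.
have mU : measurable (\big[setU/set0]_(i < n) F i) by exact: bigsetU_measurable.
have muU : (mu (\big[setU/set0]_(i < n) F i) < d%:E)%E.
  rewrite measure_bigsetU_ord//.
  rewrite (eq_bigr (fun i => (v i - u i)%:E)).
    by rewrite sumEFin lte_fin.
  by move=> i _; exact: muF.
apply: le_lt_trans (hd _ mU muU).
have intf A : measurable A -> mu.-integrable A (EFin \o (f \_ `[a, b])).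
  move=> mA; apply: (@integrableS _ _ _ mu setT) => //.
  by rewrite -restrict_EFin; apply/integrable_restrict => //=; rewrite setTI.
rewrite -lee_fin [leRHS]fineK; last first.
  apply: integrable_fin_num => //.
  exact: integrable_norm (intf _ mU).
rewrite (@ge0_integral_bigsetU _ _ _ mu _ F)//; last 3 first.
- exact: index_enum_uniq.
- by apply: sub_trivIset tF.
- by apply: (@measurable_int _ _ _ mu); exact: integrable_norm (intf _ mU).
rewrite -sumEFin; apply: lee_sum => i _.
have [ai [uvi vb]] := uv i.
rewrite primB// -Rintegral_itv_obnd_cbnd; last first.
  by apply: (integrableS _ _ _ (lf (u i) (v i))) => //; exact: subset_itv_oc_cc.
rewrite (@eq_Rintegral _ _ _ mu _ (f \_ `[a, b])); last first.
  move=> x /[!inE]/=; rewrite in_itv/= => /andP[ux xv].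
  by rewrite patchE mem_set//= in_itv/= (le_trans ai (ltW ux)) (le_trans xv).
rewrite (le_trans (_ : _ <= (\int[mu]_(x in F i) `|(f \_ `[a, b]) x|)%:E)%E)//.
  by rewrite lee_fin le_normr_Rintegral//; exact: intf.
rewrite fineK//; apply: integrable_fin_num; first exact: mF.
exact: integrable_norm (intf _ (mF i)).
Qed.

Lemma prim_acd c f : loc_integrable f -> acd (prim c f) f.
Proof. by move=> lf; split; [exact: prim_ACloc | exact: prim_derive]. Qed.

End Primitive.

(** * Linear systems with locally integrable coefficients *)

Section LinearODE.
Context {R : realType} {n : nat}.
Local Notation mu := (@lebesgue_measure R).
Context (A : 'I_n -> 'I_n -> R -> R) (y0 : 'I_n -> R) (c : R).
Context (lA : forall i j, loc_integrable (A i j)).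
Implicit Types (Y : 'I_n -> R -> R) (x : R) (k : nat) (i j : 'I_n).

Let G Y i x : R := \sum_(j < n) A i j x * Y j x.

(** Starting from 0 rather than from [y0] makes each iterate a partial sum of the differences [D],
    whose term of index 0 is the constant [y0]. *)
Fixpoint picard k i x : R :=
  if k is k'.+1 then y0 i + prim c (G (picard k') i) x else 0.

Let a x : R := \sum_(i < n) \sum_(j < n) `|A i j x|.
Let g := prim c a.
Let C : R := \sum_(i < n) `|y0 i|.
Let D k i x : R := picard k.+1 i x - picard k i x.

Let loc_integrable_G Y i : (forall j, continuous (Y j)) -> loc_integrable (G Y i).
Proof. by move=> cY; apply: loc_integrable_sum => j; exact: loc_integrableM. Qed.

Let loc_integrable_a : loc_integrable a.
Proof.
by apply: loc_integrable_sum => i; apply: loc_integrable_sum => j; exact: loc_integrable_norm.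
Qed.

Let a_ge0 x : 0 <= a x.
Proof. by apply: sumr_ge0 => i _; apply: sumr_ge0. Qed.

Let C_ge0 : 0 <= C. Proof. exact: sumr_ge0. Qed.

Let g_acd : acd g a. Proof. exact: prim_acd. Qed.

Let y0_le i : `|y0 i| <= C.
Proof. by rewrite /C (bigD1 i)//= lerDl sumr_ge0. Qed.

Let picard_continuous k i : continuous (picard k i).
Proof.
elim: k i => [|k IH] i /=; first by move=> x; exact: cst_continuous.
apply: acd_continuous; apply: acdD; first exact: acd_cst.
by apply: prim_acd; exact: loc_integrable_G.
Qed.

Let picard_acd k i : acd (picard k.+1 i) (G (picard k) i).
Proof.
apply: acd_ae (acdD (acd_cst _) (prim_acd c _)) _; first exact: loc_integrable_G.
by apply: aeW => x; rewrite add0r.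
Qed.

Let D_acd k i : acd (D k.+1 i) (G (D k) i).
Proof.
apply: acd_ae (acdB (picard_acd k.+1 i) (picard_acd k i)) _.
by apply: aeW => x; rewrite /G -sumrB; apply: eq_bigr => j _; rewrite mulrBr.
Qed.

Let D_base k i : D k.+1 i c = 0.
Proof. by rewrite /D /= !prim_base !addr0 subrr. Qed.

Let D0 i x : D 0 i x = y0 i.
Proof.
rewrite /D/= subr0 (_ : G _ i = fun=> 0); last first.
  by apply/funext => t; rewrite /G big1// => j _; rewrite mulr0.
by rewrite /prim !Rintegral_cst// !mul0r subrr addr0.
Qed.

Let G_le Y i x M : (forall j, `|Y j x| <= M) -> `|G Y i x| <= a x * M.
Proof.
move=> YM; rewrite /G (le_trans (ler_norm_sum _ _ _))//.
(* A negative M is excluded by the index i itself, through [|Y i x| <= M]. *)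
have [M0|M0] := leP 0 M; last first.
  by have := le_lt_trans (YM i) M0; rewrite normr_lt0.
apply: (@le_trans _ _ (\sum_(j < n) `|A i j x| * M)).
  by apply: ler_sum => j _; rewrite normrM ler_wpM2l.
rewrite -mulr_suml ler_wpM2r// /a [leRHS](bigD1 i)//= lerDl.
by apply: sumr_ge0 => k _; apply: sumr_ge0.
Qed.

(* [E s] is the weight e^(2 s g); the factor 2 turns each Picard step into a contraction by 1/2. *)
Let E (s : R) x : R := expR (2 * s * g x).

Let E_acd s K : acd (fun x => K * E s x) (fun x => K * (2 * s * a x * E s x)).
Proof. by apply: acdZ; apply: acd_expR; exact: acdZ. Qed.

Let E_base s : E s c = 1.
Proof. by rewrite /E /g prim_base mulr0 expR0. Qed.

(** The majorant of rank k+1 has as derivative [a] times the majorant of rank k, and by induction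
    that bounds the derivative of [D k.+1] in absolute value. At c the difference vanishes while the
    majorant is nonnegative. *)
Let D_le_r k i x : c <= x -> `|D k i x| <= C * 2^-1 ^+ k * E 1 x.
Proof.
elim: k i x => [|k IH] i x cx.
  rewrite D0 expr0 mulr1.
  have : 1 <= E 1 x.
    have : 0 <= g x - g c.
      by have := acd_le cx (acd_cst 0) g_acd; rewrite subrr; apply; apply: aeW => t _.
    rewrite {2}/g prim_base subr0 => g0; rewrite /E.
    by have := expR_ge1Dx (2 * 1 * g x); lra.
  by move=> E1; rewrite (le_trans (y0_le i))// ler_peMr.
have W0 : 0 <= C * 2^-1 ^+ k.+1 by rewrite mulr_ge0// exprn_ge0.
have key t : c < t < x -> `|G (D k) i t| <= C * 2^-1 ^+ k.+1 * (2 * 1 * a t * E 1 t).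
  move=> /andP[ct _]; apply: (le_trans (G_le _ (fun j => IH j t (ltW ct)))).
  by rewrite exprS le_eqVlt; apply/orP; left; apply/eqP; field.
have h1 : D k.+1 i x - D k.+1 i c <= C * 2^-1 ^+ k.+1 * E 1 x - C * 2^-1 ^+ k.+1 * E 1 c.
  apply: (acd_le cx (D_acd k i) (E_acd 1 _)); apply: aeW => t /key.
  by apply: le_trans; exact: ler_norm.
have h2 : - D k.+1 i x - - D k.+1 i c <= C * 2^-1 ^+ k.+1 * E 1 x - C * 2^-1 ^+ k.+1 * E 1 c.
  apply: (acd_le cx (acdN (D_acd k i)) (E_acd 1 _)); apply: aeW => t /key.
  by apply: le_trans; rewrite -normrN; exact: ler_norm.
by move: h1 h2; rewrite D_base E_base ler_norml; lra.
Qed.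

(** To the left of c the weight must grow leftwards, hence s = -1; as this weight decreases in x,
    the comparison uses the majorant with a minus sign. *)
Let D_le_l k i x : x <= c -> `|D k i x| <= C * 2^-1 ^+ k * E (-1) x.
Proof.
elim: k i x => [|k IH] i x xc.
  rewrite D0 expr0 mulr1.
  have : 1 <= E (-1) x.
    have : 0 <= g c - g x.
      by have := acd_le xc (acd_cst 0) g_acd; rewrite subrr; apply; apply: aeW => t _.
    rewrite {1}/g prim_base => g0; rewrite /E.
    by have := expR_ge1Dx (2 * -1 * g x); lra.
  by move=> E1; rewrite (le_trans (y0_le i))// ler_peMr.
have W0 : 0 <= C * 2^-1 ^+ k.+1 by rewrite mulr_ge0// exprn_ge0.
have key t : x < t < c -> `|G (D k) i t| <= - C * 2^-1 ^+ k.+1 * (2 * -1 * a t * E (-1) t).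
  move=> /andP[_ tc]; apply: (le_trans (G_le _ (fun j => IH j t (ltW tc)))).
  by rewrite exprS le_eqVlt; apply/orP; left; apply/eqP; field.
have h1 : D k.+1 i c - D k.+1 i x <=
    - C * 2^-1 ^+ k.+1 * E (-1) c - - C * 2^-1 ^+ k.+1 * E (-1) x.
  apply: (acd_le xc (D_acd k i) (E_acd (-1) _)); apply: aeW => t /key.
  by apply: le_trans; exact: ler_norm.
have h2 : - D k.+1 i c - - D k.+1 i x <=
    - C * 2^-1 ^+ k.+1 * E (-1) c - - C * 2^-1 ^+ k.+1 * E (-1) x.
  apply: (acd_le xc (acdN (D_acd k i)) (E_acd (-1) _)); apply: aeW => t /key.
  by apply: le_trans; rewrite -normrN; exact: ler_norm.
by move: h1 h2; rewrite D_base E_base ler_norml; lra.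
Qed.

(** Adding the weights of the two sides gives one continuous majorant on the whole line. *)
Let B x : R := C * (E 1 x + E (-1) x).

Let D_le k i x : `|D k i x| <= B x * 2^-1 ^+ k.
Proof.
have E0 s : 0 <= C * 2^-1 ^+ k * E s x.
  by rewrite !mulr_ge0 ?expR_ge0// exprn_ge0.
have [cx|/ltW xc] := leP c x.
  by have := D_le_r k i cx; have := E0 (-1); rewrite /B; lra.
by have := D_le_l k i xc; have := E0 1; rewrite /B; lra.
Qed.

Let picard_series i x : (fun k => picard k i x) = series (fun k => D k i x).
Proof.
apply/funext => k; rewrite /series/=; elim: k => [|k IH]; first by rewrite big_geq.
by rewrite big_nat_recr//= -IH /D subrKC.
Qed.

Let picard_le k i x : `|picard k i x| <= 2 * B x.
Proof.
(* The subtracted term makes the bound the exact partial sum of the geometric series, which the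
   induction can carry. *)
suff H : `|picard k i x| <= 2 * B x - 2 * B x * 2^-1 ^+ k.
  apply: (le_trans H); rewrite gerBl !mulr_ge0 ?addr_ge0 ?expR_ge0//.
elim: k => [|k IH]; first by rewrite /= normr0 expr0 mulr1 subrr.
rewrite -(subrKC (picard k i x) (picard k.+1 i x)).
apply: (le_trans (ler_normD _ _)); have := D_le k i x; rewrite /D exprS.
by move: IH; lra.
Qed.

Let picard_cvg i x : cvgn (fun k => picard k i x).
Proof.
rewrite picard_series; apply: normed_cvg.
apply: (@series_le_cvg _ _ (geometric (B x) 2^-1)) => [k|k|k|].
- exact: normr_ge0.
- exact: le_trans (normr_ge0 _) (D_le k i x).
- exact: D_le.
- by apply: is_cvg_geometric_series; rewrite ger0_norm ?invr_ge0// invf_lt1// ltr1n.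
Qed.

Let Y i x : R := limn (fun k => picard k i x).

Let picard_Y i x : picard k i x @[k --> \oo] --> Y i x.
Proof. exact: picard_cvg. Qed.

Let Y_le i x : `|Y i x| <= 2 * B x.
Proof.
have H : `|picard k i x| @[k --> \oo] --> `|Y i x| by apply: cvg_norm; exact: picard_Y.
by rewrite -(cvg_lim _ H)//; apply: limr_le; [exact: cvgP H | near=> k; exact: picard_le].
Unshelve. all: by end_near. Qed.

Let B_continuous : continuous (fun x => 2 * B x).
Proof.
exact: acd_continuous (acdZ 2 (acdZ C (acdD
  (acd_expR (acdZ (2 * 1) g_acd)) (acd_expR (acdZ (2 * -1) g_acd))))).
Qed.

Let aB_integrable : loc_integrable (fun x => a x * (2 * B x)).
Proof. exact: (loc_integrableM loc_integrable_a B_continuous). Qed.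

Let G_measurable k i : measurable_fun setT (G (picard k) i).
Proof. by apply: loc_integrable_measurable; exact: loc_integrable_G. Qed.

Let G_cvg i x : G (picard k) i x @[k --> \oo] --> G Y i x.
Proof.
have H (s : seq 'I_n) : \sum_(j <- s) A i j x * picard k j x @[k --> \oo] -->
    \sum_(j <- s) A i j x * Y j x.
  elim: s => [|j s IH].
    by rewrite big_nil; under eq_fun do rewrite big_nil; exact: cvg_cst.
  rewrite big_cons; under eq_fun do rewrite big_cons.
  by apply: cvgD => //; apply: cvgM; [exact: cvg_cst | exact: picard_Y].
exact: H.
Qed.

Let GY_measurable i : measurable_fun setT (G Y i).
Proof. by apply: (measurable_fun_cvg (fun k => G_measurable k i)) => x _; exact: G_cvg. Qed.

Let GY_integrable i : loc_integrable (G Y i).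
Proof.
apply: (loc_integrable_le (GY_measurable i) _ aB_integrable) => x.
by apply: G_le => j; exact: Y_le.
Qed.

Let Rintegral_G_cvg i u v : \int[mu]_(x in `[u, v]) G (picard k) i x @[k --> \oo] -->
  \int[mu]_(x in `[u, v]) G Y i x.
Proof.
apply: fine_cvg; rewrite fineK; last by apply: integrable_fin_num => //; exact: GY_integrable.
apply: (@dominated_cvg _ _ _ mu _ _ _ _ (fun x => (a x * (2 * B x))%:E)) => //.
- by move=> k; apply/measurable_EFinP; apply: measurable_funTS; exact: G_measurable.
- by move=> x _; apply: cvg_EFin; [exact: nearW | exact: G_cvg].
- by move=> k x _; rewrite lee_fin; apply: G_le => j; exact: picard_le.
Qed.

Let Y_fix i x : Y i x = y0 i + prim c (G Y i) x.
Proof.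
have H1 : picard k.+1 i x @[k --> \oo] --> Y i x by have := picard_Y (i := i) (x := x); rewrite -cvg_shiftS.
have H2 : picard k.+1 i x @[k --> \oo] --> y0 i + prim c (G Y i) x.
  by apply: cvgD; [exact: cvg_cst | apply: cvgB; exact: Rintegral_G_cvg].
exact: cvg_unique H1 H2.
Qed.

Lemma linear_ode_exists : exists Y : 'I_n -> R -> R,
  (forall i, acd (Y i) (fun x => \sum_(j < n) A i j x * Y j x)) /\
  (forall i, Y i c = y0 i).
Proof.
exists Y; split=> i; last by rewrite Y_fix prim_base addr0.
rewrite (_ : Y i = fun x => y0 i + prim c (G Y i) x); last first.
  by apply/funext => x; exact: Y_fix.
apply: acd_ae (acdD (acd_cst _) (prim_acd c (GY_integrable i))) _.
by apply: aeW => x; rewrite add0r.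
Qed.

End LinearODE.

(** * The Dirac system *)

Section DiracSystem.
Context {R : realType}.
Local Notation mu := (@lebesgue_measure R).
Local Notation C := R[i].
Local Notation Re := (@complex.Re R).
Local Notation Im := (@complex.Im R).
Implicit Types (f g : R -> C) (q : R -> C) (z w : C) (F G Phi Psi : R -> C * C) (a b c s t x : R).

Lemma ReD z w : Re (z + w) = Re z + Re w. Proof. by case: z; case: w. Qed.
Lemma ImD z w : Im (z + w) = Im z + Im w. Proof. by case: z; case: w. Qed.
Lemma ReN z : Re (- z) = - Re z. Proof. by case: z. Qed.
Lemma ImN z : Im (- z) = - Im z. Proof. by case: z. Qed.
Lemma ReM z w : Re (z * w) = Re z * Re w - Im z * Im w.
Proof. by case: z; case: w. Qed.
Lemma ImM z w : Im (z * w) = Re z * Im w + Im z * Re w.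
Proof. by case: z; case: w. Qed.
Lemma Re_conj z : Re (conjc z) = Re z. Proof. by case: z. Qed.
Lemma Im_conj z : Im (conjc z) = - Im z. Proof. by case: z. Qed.
Definition ReImE := (ReD, ImD, ReN, ImN, ReM, ImM, Re_conj, Im_conj).

Lemma ReIm_eq z w : Re z = Re w -> Im z = Im w -> z = w.
Proof. by case: z => a b; case: w => a' b' /= -> ->. Qed.

Definition cacd f f' :=
  acd (fun x => Re (f x)) (fun x => Re (f' x)) /\
  acd (fun x => Im (f x)) (fun x => Im (f' x)).

Lemma cacd_ae f f' g' : cacd f f' -> {ae mu, forall x, f' x = g' x} -> cacd f g'.
Proof.
by move=> [fr fi] fg; split; [apply: acd_ae fr _ | apply: acd_ae fi _];
  apply: filterS fg => x ->.
Qed.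

Lemma cacd_cst z : cacd (fun=> z) (fun=> 0).
Proof. by split; exact: acd_cst. Qed.

Lemma cacdD f f' g g' : cacd f f' -> cacd g g' ->
  cacd (fun x => f x + g x) (fun x => f' x + g' x).
Proof.
move=> [fr fi] [gr gi]; split.
  under eq_fun do rewrite ReD; under [X in acd _ X]eq_fun do rewrite ReD.
  exact: acdD.
under eq_fun do rewrite ImD; under [X in acd _ X]eq_fun do rewrite ImD.
exact: acdD.
Qed.

Lemma cacdM f f' g g' : cacd f f' -> cacd g g' ->
  cacd (fun x => f x * g x) (fun x => f' x * g x + f x * g' x).
Proof.
move=> [fr fi] [gr gi]; split.
  under eq_fun do rewrite ReM.
  apply: acd_ae (acdB (acdM fr gr) (acdM fi gi)) _.
  by apply: aeW => x; rewrite !ReImE; ring.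
under eq_fun do rewrite ImM.
apply: acd_ae (acdD (acdM fr gi) (acdM fi gr)) _.
by apply: aeW => x; rewrite !ReImE; ring.
Qed.

Lemma cacdZ z f f' : cacd f f' -> cacd (fun x => z * f x) (fun x => z * f' x).
Proof.
move=> fd; apply: cacd_ae (cacdM (cacd_cst z) fd) _.
by apply: aeW => x; rewrite mul0r add0r.
Qed.

Lemma cacdN f f' : cacd f f' -> cacd (fun x => - f x) (fun x => - f' x).
Proof.
move=> /(cacdZ (-1)); under eq_fun do rewrite mulN1r.
by under [X in cacd _ X]eq_fun do rewrite mulN1r.
Qed.

Lemma cacd_conj f f' : cacd f f' ->
  cacd (fun x => conjc (f x)) (fun x => conjc (f' x)).
Proof.
move=> [fr fi]; split.
  by under eq_fun do rewrite Re_conj; under [X in acd _ X]eq_fun do rewrite Re_conj.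
under eq_fun do rewrite Im_conj; under [X in acd _ X]eq_fun do rewrite Im_conj.
exact: acdN.
Qed.

Lemma cacd_derivable f f' : cacd f f' ->
  cACloc f /\ {ae mu, forall x, cderivable f x /\ cder f x = f' x}.
Proof.
move=> [[fr dr] [fi di]]; split=> //; apply: filterS2 dr di => x dr di; split.
  by split; [apply: (@ex_derive _ _ _ _ _ _ _ dr) | apply: (@ex_derive _ _ _ _ _ _ _ di)].
by apply: ReIm_eq; rewrite /cder/= derive1E; [exact: (@derive_val _ _ _ _ _ _ _ dr) |
  exact: (@derive_val _ _ _ _ _ _ _ di)].
Qed.

Lemma derivable_cacd f f' : cACloc f ->
  {ae mu, forall x, cderivable f x /\ cder f x = f' x} -> cacd f f'.
Proof.
move=> [fr fi] df; split; split=> //; apply: filterS df => x [[dr di] <-];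
  by rewrite /cder/= derive1E; exact: derivableP.
Qed.

(* [sol q z G F] says that (M(q) - z) F = G, solved for the derivatives of F. *)
Definition sol q z G F :=
  cacd (fun x => (F x).1)
    (fun x => - 'i%C * z * (F x).1 + q x * (F x).2 - 'i%C * (G x).1) /\
  cacd (fun x => (F x).2)
    (fun x => 'i%C * z * (F x).2 - conjc (q x) * (F x).1 + 'i%C * (G x).2).

Definition sol0 q z := sol q z (fun=> (0, 0)).

Definition sqnorm F x : R := cabs2 (F x).1 + cabs2 (F x).2.

Definition wronskian Phi F x : C := (Phi x).1 * (F x).2 - (Phi x).2 * (F x).1.

Lemma cabs2_ge0 z : 0 <= cabs2 z.
Proof. by rewrite addr_ge0// sqr_ge0. Qed.

Lemma cabs2_eq0 z : (cabs2 z == 0) = (z == 0).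
Proof.
case: z => a b; rewrite /cabs2/= paddr_eq0 ?sqr_ge0// !sqrf_eq0.
by rewrite eq_complex.
Qed.

Lemma cabs2M z w : cabs2 (z * w) = cabs2 z * cabs2 w.
Proof. by rewrite /cabs2 !ReImE; ring. Qed.

Lemma sqnorm_ge0 F x : 0 <= sqnorm F x.
Proof. by rewrite addr_ge0 ?cabs2_ge0. Qed.

Lemma sqnorm_eq0 F x : sqnorm F x = 0 -> F x = (0, 0).
Proof.
move=> /eqP; rewrite paddr_eq0 ?cabs2_ge0// !cabs2_eq0.
by case: (F x) => u v /= /andP[/eqP-> /eqP->].
Qed.

Lemma vnorm_sqr F x : vnorm F x ^+ 2 = sqnorm F x.
Proof. by rewrite sqr_sqrtr// sqnorm_ge0. Qed.

Lemma sqnormZ F G z x : F x = (z * (G x).1, z * (G x).2) -> sqnorm F x = cabs2 z * sqnorm G x.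
Proof. by move=> Fx; rewrite {1}/sqnorm Fx /= !cabs2M -mulrDr. Qed.

Lemma cabs2_wronskian Phi F x : cabs2 (wronskian Phi F x) <= sqnorm Phi x * sqnorm F x.
Proof.
rewrite /wronskian /sqnorm /cabs2 !ReImE.
case: (Phi x) => -[a b] [c d]; case: (F x) => -[a' b'] [c' d'] /=.
(* Lagrange's identity: the right side minus the left is the squared modulus of the Hermitian
   product of [Phi x] and [F x]; the two squares are those of its real and imaginary parts. *)
have h1 := sqr_ge0 (a * a' + b * b' + c * c' + d * d').
have h2 := sqr_ge0 (b * a' - a * b' + d * c' - c * d').
rewrite -subr_ge0; apply: le_trans (addr_ge0 h1 h2) _.
by rewrite le_eqVlt; apply/orP; left; apply/eqP; ring.
Qed.

Lemma cacd_continuous f f' : cacd f f' ->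
  continuous (fun x => Re (f x)) /\ continuous (fun x => Im (f x)).
Proof. by move=> [fr fi]; split; [exact: acd_continuous fr | exact: acd_continuous fi]. Qed.

Lemma sol_sqnorm_acd q z G F : sol q z G F -> exists2 N', acd (sqnorm F) N' &
  forall x, G x = (0, 0) ->
    N' x = 2 * Im z * (cabs2 (F x).1 - cabs2 (F x).2).
Proof.
move=> [[f1r f1i] [f2r f2i]].
have H := acdD (acdD (acdM f1r f1r) (acdM f1i f1i)) (acdD (acdM f2r f2r) (acdM f2i f2i)).
eexists.
  rewrite (_ : sqnorm F = (fun x =>
    Re (F x).1 * Re (F x).1 + Im (F x).1 * Im (F x).1 +
    (Re (F x).2 * Re (F x).2 + Im (F x).2 * Im (F x).2))).
    exact: H.
  by apply/funext => x; rewrite /sqnorm /cabs2 !expr2.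
by move=> x /= ->; rewrite /cabs2 !ReImE /=; ring.
Qed.

Lemma sol_sqnorm_continuous q z G F : sol q z G F -> continuous (sqnorm F).
Proof. by move=> /sol_sqnorm_acd[N' /acd_continuous]. Qed.

(* The potential is skew-adjoint in the real inner product, so it drops out of the growth of |F|^2. *)
Lemma sol_growth q z G F a b : sol q z G F -> a <= b ->
  (forall x, a < x < b -> G x = (0, 0)) ->
  sqnorm F b <= expR (2 * `|Im z| * (b - a)) * sqnorm F a /\
  sqnorm F a <= expR (2 * `|Im z| * (b - a)) * sqnorm F b.
Proof.
move=> FG ab G0; have [N' NN' NE] := sol_sqnorm_acd FG.
pose k := 2 * `|Im z|.
have bnd x : a < x < b -> `|N' x| <= k * sqnorm F x.
  move=> /G0/NE ->; rewrite /k -!mulrA !normrM ger0_norm// ler_wpM2l// ler_wpM2l//.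
  have := cabs2_ge0 (F x).1; have := cabs2_ge0 (F x).2; rewrite /sqnorm ler_norml; lra.
(* Grönwall in both directions: |F|^2 e^(-kx) does not increase and |F|^2 e^(kx) does not
   decrease. *)
have dec : sqnorm F b * expR (- k * b) <= sqnorm F a * expR (- k * a).
  have H := acdM NN' (acd_expR (acdZ (- k) acd_id)).
  have := acd_le ab H (acd_cst 0); rewrite subrr subr_le0; apply.
  apply: aeW => x /bnd; rewrite ler_norml => /andP[_ h].
  by have := expR_gt0 (- k * x); nra.
have inc : sqnorm F a * expR (k * a) <= sqnorm F b * expR (k * b).
  have H := acdM NN' (acd_expR (acdZ k acd_id)).
  have := acd_le ab (acd_cst 0) H; rewrite subrr subr_ge0; apply.
  apply: aeW => x /bnd; rewrite ler_norml => /andP[h _].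
  by have := expR_gt0 (k * x); nra.
split.
- rewrite -/k; move: dec; rewrite -(ler_pM2r (expR_gt0 (k * b))) -mulrA -expRD.
  rewrite mulNr addNr expR0 mulr1 => /le_trans; apply.
  by rewrite -mulrA -expRD mulrC le_eqVlt; apply/orP; left; apply/eqP; congr (expR _ * _); ring.
- rewrite -/k; move: inc; rewrite -(ler_pM2r (expR_gt0 (- k * a))) -mulrA -expRD.
  rewrite mulNr addrN expR0 mulr1 => /le_trans; apply.
  by rewrite -mulrA -expRD mulrC le_eqVlt; apply/orP; left; apply/eqP; congr (expR _ * _); ring.
Qed.

(** Uniqueness in the Cauchy problem follows from the two-sided growth bound, whose exponent
    involves Im z but not q. *)
Lemma sol_eq0 q z G F a b c x : sol q z G F -> a <= c <= b -> a <= x <= b ->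
  (forall t, a < t < b -> G t = (0, 0)) -> F c = (0, 0) -> F x = (0, 0).
Proof.
move=> FG /andP[ac cb] /andP[ax xb] G0 Fc; apply: sqnorm_eq0; apply/le_anti; rewrite sqnorm_ge0 andbT.
have nc : sqnorm F c = 0 by rewrite /sqnorm Fc /cabs2/= expr0n/= !addr0.
have [cx|/ltW xc] := leP c x.
  have [|+ _] := sol_growth FG cx; last by rewrite nc mulr0.
  by move=> t /andP[ct tx]; apply: G0; rewrite (le_lt_trans ac) ?(lt_le_trans tx).
have [|_ +] := sol_growth FG xc; last by rewrite nc mulr0.
by move=> t /andP[xt tc]; apply: G0; rewrite (le_lt_trans ax) ?(lt_le_trans tc).
Qed.

Lemma sol_lin q z G F Phi w : sol q z G F -> sol0 q z Phi ->
  sol q z G (fun x => ((F x).1 - w * (Phi x).1, (F x).2 - w * (Phi x).2)).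
Proof.
move=> [F1 F2] [P1 P2]; split.
  apply: cacd_ae (cacdD F1 (cacdN (cacdZ w P1))) _.
  by apply: aeW => x /=; ring.
apply: cacd_ae (cacdD F2 (cacdN (cacdZ w P2))) _.
by apply: aeW => x /=; ring.
Qed.

(** The factor w lets one lemma serve for uniqueness (w = 1), for propagation of proportionality,
    and for zeros (w = 0). *)
Lemma sol_agree q z G F Phi c w : sol q z G F -> sol0 q z Phi ->
  F c = (w * (Phi c).1, w * (Phi c).2) ->
  forall a b, a <= c <= b -> (forall t, a < t < b -> G t = (0, 0)) ->
  forall x, a <= x <= b -> F x = (w * (Phi x).1, w * (Phi x).2).
Proof.
move=> FG P Fc a b acb G0 x axb.
have /= := sol_eq0 (sol_lin w FG P) acb axb G0.
rewrite Fc !subrr => /(_ erefl) [/eqP h1 /eqP h2].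
rewrite subr_eq0 in h1; rewrite subr_eq0 in h2.
by rewrite (surjective_pairing (F x)) (eqP h1) (eqP h2).
Qed.

Lemma sol0_agree q z Phi Psi c w : sol0 q z Psi -> sol0 q z Phi ->
  Psi c = (w * (Phi c).1, w * (Phi c).2) ->
  forall x, Psi x = (w * (Phi x).1, w * (Phi x).2).
Proof.
move=> Ps P Pc x.
apply: (sol_agree Ps P Pc (a := Num.min c x) (b := Num.max c x)) => //.
  by rewrite ge_min lexx le_max lexx.
by rewrite ge_min lexx le_max lexx !orbT.
Qed.

(** The matrix of the system has trace 0, so only the source G contributes to the derivative. *)
Lemma wronskian_acd q z G F Phi : sol q z G F -> sol0 q z Phi ->
  cacd (wronskian Phi F) (fun x => 'i%C * ((Phi x).1 * (G x).2 + (Phi x).2 * (G x).1)).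
Proof.
move=> [F1 F2] [P1 P2].
apply: cacd_ae (cacdD (cacdM P1 F2) (cacdN (cacdM P2 F1))) _.
by apply: aeW => x /=; ring.
Qed.

Lemma wronskian_cst q z Phi Psi : sol0 q z Psi -> sol0 q z Phi ->
  forall x y, wronskian Phi Psi x = wronskian Phi Psi y.
Proof.
move=> Ps P x y; have [wr wi] := wronskian_acd Ps P.
have re0 : acd (fun t => Re (wronskian Phi Psi t)) (fun=> 0).
  by apply: acd_ae wr _; apply: aeW => t /=; rewrite !mulr0 addr0 mulr0.
have im0 : acd (fun t => Im (wronskian Phi Psi t)) (fun=> 0).
  by apply: acd_ae wi _; apply: aeW => t /=; rewrite !mulr0 addr0 mulr0.
by apply: ReIm_eq; [exact: acd0_cst re0 x y | exact: acd0_cst im0 x y].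
Qed.

(** A vanishing 2 by 2 determinant makes the values at c proportional, and uniqueness propagates
    this to the line. *)
Lemma wronskian0_proportional q z Phi Psi c : sol0 q z Psi -> sol0 q z Phi ->
  Phi c <> (0, 0) -> wronskian Phi Psi c = 0 ->
  exists w, forall x, Psi x = (w * (Phi x).1, w * (Phi x).2).
Proof.
move=> Ps P Pc; rewrite /wronskian => /eqP; rewrite subr_eq0 => /eqP W0.
suff [w Hw] : exists w, Psi c = (w * (Phi c).1, w * (Phi c).2).
  by exists w; exact: sol0_agree Ps P Hw.
move: Pc W0; case: (Phi c) => u v; case: (Psi c) => u' v' /= uv W0.
have [u0|u0] := eqVneq u 0.
  have v0 : v != 0 by apply/eqP => v0; apply: uv; rewrite u0 v0.
  exists (v' / v); rewrite divfK// u0 mulr0; congr (_, _).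
  by apply/eqP; move/eqP: W0; rewrite u0 mul0r eq_sym mulf_eq0 (negbTE v0).
by exists (u' / u); rewrite divfK//; congr (_, _); rewrite mulrAC [u' * v]mulrC -W0 mulrAC divff// mul1r.
Qed.

Lemma sol0_exists q z c (v : C * C) : cLloc1 q -> exists2 Phi, sol0 q z Phi & Phi c = v.
Proof.
move=> [lr li]; pose X := Re z; pose Y := Im z.
pose p x := Re (q x); pose r x := Im (q x).
(* The matrix of the system in the real unknowns Re F_1, Im F_1, Re F_2, Im F_2, read off from -iz =
   Y - iX and q = p + ir. *)
pose rows : seq (seq (R -> R)) := [::
  [:: fun=> Y; fun=> X; fun x => p x; fun x => - r x];
  [:: fun=> - X; fun=> Y; fun x => r x; fun x => p x];
  [:: fun x => - p x; fun x => - r x; fun=> - Y; fun=> - X];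
  [:: fun x => r x; fun x => - p x; fun=> X; fun=> - Y]].
pose A (i j : 'I_4) := nth (fun=> 0) (nth [::] rows i) j.
have lc u : loc_integrable (fun=> u : R).
  by apply: loc_integrable_continuous => x; exact: cst_continuous.
have lN (h : R -> R) : loc_integrable h -> loc_integrable (fun x => - h x).
  move=> lh a b; rewrite (_ : _ \o _ = \- (EFin \o h))%E//; exact: integrableN.
have lA i j : loc_integrable (A i j).
  rewrite /A; case: i => -[|[|[|[|//]]]] ? /=; case: j => -[|[|[|[|//]]]] ? /=;
  by [exact: lc | exact: lr | exact: li | exact: (lN _ lr) | exact: (lN _ li)].
pose y0 (i : 'I_4) := nth 0 [:: Re v.1; Im v.1; Re v.2; Im v.2] i.
have [Z [Zd Zc]] := linear_ode_exists y0 c lA.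
pose i0 : 'I_4 := @Ordinal 4 0 isT; pose i1 : 'I_4 := @Ordinal 4 1 isT.
pose i2 : 'I_4 := @Ordinal 4 2 isT; pose i3 : 'I_4 := @Ordinal 4 3 isT.
have E4 (h : 'I_4 -> R) : \sum_(j < 4) h j = h i0 + h i1 + h i2 + h i3.
  rewrite !big_ord_recl big_ord0 addr0 !addrA.
  by congr (h _ + h _ + h _ + h _); apply: val_inj.
exists (fun x => ((Z i0 x +i* Z i1 x)%C, (Z i2 x +i* Z i3 x)%C)).
  by split; split; [apply: acd_ae (Zd i0) _ | apply: acd_ae (Zd i1) _ |
    apply: acd_ae (Zd i2) _ | apply: acd_ae (Zd i3) _];
    apply: aeW => x; rewrite E4 /A/= !ReImE/= /X /Y /p /r; ring.
by rewrite !Zc /y0/= [RHS]surjective_pairing; congr (_, _); exact: ReIm_eq.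
Qed.

End DiracSystem.

(** * Integrals of nonnegative continuous functions *)

Section NonnegIntegrals.
Context {R : realType}.
Local Notation mu := (@lebesgue_measure R).
Implicit Types (f : R -> R) (a b c r s x y M : R) (A B : set R).

Lemma continuous_measurable_EFin A f : continuous f ->
  measurable_fun A (fun x => (f x)%:E).
Proof.
move=> cf; apply/measurable_EFinP; apply: measurable_funTS.
exact: continuous_measurable_fun.
Qed.

Lemma iint_Rintegral f a b : continuous f ->
  (\iint_`[a, b] f = (\int[mu]_(x in `[a, b]) f x)%R%:E)%E.
Proof.
move=> cf; rewrite /Rintegral fineK//; apply: integrable_fin_num => //.
exact: loc_integrable_continuous.
Qed.

Lemma iint_segment_lty f a b : continuous f -> (\iint_`[a, b] f < +oo)%E.
Proof. by move=> cf; rewrite iint_Rintegral// ltry. Qed.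

Lemma iint_ge0 f A : (forall x, 0 <= f x) -> (0 <= \iint_A f)%E.
Proof. by move=> f0; apply: integral_ge0 => x _; rewrite lee_fin. Qed.

Lemma iint_fin_num f A : (forall x, 0 <= f x) -> (\iint_A f < +oo)%E ->
  (\iint_A f)%E \is a fin_num.
Proof. by move=> f0 fA; rewrite ge0_fin_numE// iint_ge0. Qed.

Lemma iint_subset f A B : continuous f -> (forall x, 0 <= f x) ->
  measurable A -> measurable B -> A `<=` B -> (\iint_A f <= \iint_B f)%E.
Proof.
move=> cf f0 mA mB AB; apply: ge0_subset_integral => //.
  exact: continuous_measurable_EFin.
by move=> x _; rewrite lee_fin.
Qed.

Lemma iint_setU_lty f A B : continuous f -> (forall x, 0 <= f x) ->
  measurable A -> measurable B -> (\iint_A f < +oo)%E -> (\iint_B f < +oo)%E ->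
  (\iint_(A `|` B) f < +oo)%E.
Proof.
move=> cf f0 mA mB fA fB.
have mBA : measurable (B `\` A) by exact: measurableD.
rewrite (_ : A `|` B = A `|` (B `\` A)); last first.
  apply/seteqP; split=> x [Ax|]; try by left.
    by move=> Bx; have [Ax|nAx] := pselect (A x); [left | right].
  by case; right.
rewrite ge0_integral_setU//.
- apply: lte_add_pinfty => //; apply: le_lt_trans fB.
  by apply: iint_subset => // x [].
- exact: continuous_measurable_EFin.
- by move=> x _; rewrite lee_fin.
- by apply/disj_setPS => x [Ax [_]].
Qed.

Lemma iint_right_lty f r s : continuous f -> (forall x, 0 <= f x) ->
  (\iint_`[r, +oo[ f < +oo)%E -> (\iint_`[s, +oo[ f < +oo)%E.
Proof.
move=> cf f0 fr.
apply: (@le_lt_trans _ _ (\iint_(`[s, r] `|` `[r, +oo[) f)).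
  apply: iint_subset => //; first exact: measurableU.
  move=> x; rewrite /= !in_itv/= !andbT => sx.
  by have [xr|/ltW rx] := leP x r; [left | right]; rewrite ?sx.
by apply: iint_setU_lty => //; exact: iint_segment_lty.
Qed.

Lemma iint_left_lty f r s : continuous f -> (forall x, 0 <= f x) ->
  (\iint_`]-oo, r] f < +oo)%E -> (\iint_`]-oo, s] f < +oo)%E.
Proof.
move=> cf f0 fr.
apply: (@le_lt_trans _ _ (\iint_(`]-oo, r] `|` `[r, s]) f)).
  apply: iint_subset => //; first exact: measurableU.
  move=> x; rewrite /= !in_itv/= => xs.
  by have [xr|/ltW rx] := leP x r; [left | right]; rewrite ?rx.
by apply: iint_setU_lty => //; exact: iint_segment_lty.
Qed.

Lemma iint_setT_lty f r s : continuous f -> (forall x, 0 <= f x) ->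
  (\iint_`]-oo, r] f < +oo)%E -> (\iint_`[s, +oo[ f < +oo)%E -> (\iint_setT f < +oo)%E.
Proof.
move=> cf f0 fr /(iint_right_lty r cf f0) fs.
rewrite (_ : setT = `]-oo, r] `|` `[r, +oo[); first exact: iint_setU_lty.
apply/esym/seteqP; split=> // x _; rewrite /= !in_itv/= andbT.
by have [xr|/ltW rx] := leP x r; [left | right].
Qed.

Lemma iint_ge_cst f A c : continuous f -> measurable A -> 0 <= c ->
  (forall x, A x -> c <= f x) -> (c%:E * mu A <= \iint_A f)%E.
Proof.
move=> cf mA c0 cf'; rewrite -(@integral_cst _ _ _ mu A mA c%:E).
by apply: ge0_le_integral => //; exact: continuous_measurable_EFin.
Qed.

Lemma iint_infinite f A c : continuous f -> measurable A -> mu A = +oo%E ->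
  0 < c -> (forall x, A x -> c <= f x) -> \iint_A f = +oo%E.
Proof.
move=> cf mA muA c0 cf'; apply/eqP; rewrite -leye_eq.
have := iint_ge_cst cf mA (ltW c0) cf'.
by rewrite muA gt0_muley ?lte_fin.
Qed.

Lemma iint_left_le f r M : continuous f -> (forall x, 0 <= f x) ->
  (forall s, s < r -> (\iint_`[s, r] f <= M%:E)%E) -> (\iint_`]-oo, r] f <= M%:E)%E.
Proof.
move=> cf f0 fM.
(* The shift to [n.+1] keeps every left end point strictly below r, as [fM] requires. *)
have UE : \bigcup_(n : nat) `[r - n.+1%:R, r]%classic = `]-oo, r]%classic :> set R.
  apply/seteqP; split=> x /=; first by move=> [n _] /=; rewrite !in_itv/= => /andP[].
  rewrite in_itv/= => xr; exists (Num.bound (r - x)) => //=.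
  rewrite in_itv/= xr andbT lerBlDr addrC -lerBlDr ltW//.
  rewrite (lt_trans (archi_boundP _)) ?subr_ge0//.
  by rewrite ltr_nat.
have H := @ge0_nondecreasing_set_cvg_integral _ (measurableTypeR R) R
  (fun n : nat => `[r - n.+1%:R, r]%classic) (fun x => (f x)%:E) mu.
have ndF : nondecreasing_seq (fun n : nat => `[r - n.+1%:R, r]%classic : set (measurableTypeR R)).
  move=> m n mn; apply/subsetPset; apply: subset_itvr.
  by rewrite bnd_simp lerD2l lerN2 ler_nat.
have {}H := H ndF (fun n => measurable_itv _)
  (fun n => continuous_measurable_EFin cf) (fun n x _ => f0 x).
rewrite -UE; apply: (cvge_to_le H).
by apply: nearW => n; apply: fM; rewrite ltrBlDr ltrDl ltr0n.
Qed.

(** Past a point where J is within e of its supremum, no increment can reach e. Applied to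
    primitives, this makes integrals over unit windows small near infinity. *)
Lemma bounded_increment (J : R -> R) M e : {homo J : x y / x <= y} ->
  (forall x, J x <= M) -> 0 < e -> exists x0, forall x, x0 <= x -> J (x + 1) - J x < e.
Proof.
move=> Jm JM e0.
have sJ : has_sup (range J) by split; [exists (J 0), 0 | exists M => _ [x _ <-]].
have [_ [x0 _ <-] Jx0] := sup_adherent e0 sJ.
exists x0 => x /Jm xx0.
have : J (x + 1) <= sup (range J) by apply: ub_le_sup; [case: sJ | exists (x + 1)].
lra.
Qed.

Lemma iint_right_tail f e : continuous f -> (forall x, 0 <= f x) ->
  (\iint_`[0%R, +oo[ f < +oo)%E -> 0 < e ->
  exists x0, forall x, x0 <= x -> \int[mu]_(t in `[x, x + 1]) f t < e.
Proof.
move=> cf f0 fI e0; have lf := loc_integrable_continuous cf.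
have Jm : {homo prim 0 f : x y / x <= y}.
  by move=> x y xy; rewrite -subr_ge0 primB// Rintegral_ge0.
have [|x0 H] := bounded_increment (M := fine (\iint_`[0%R, +oo[ f)) Jm _ e0.
  move=> x; apply: (le_trans (Jm _ _ (_ : x <= Num.max 0 x))); first by rewrite le_max lexx orbT.
  have m0 : 0 <= Num.max 0 x by rewrite le_max lexx.
  have -> : prim 0 f (Num.max 0 x) = \int[mu]_(t in `[0, Num.max 0 x]) f t.
    by rewrite -(primB 0 lf m0) prim_base subr0.
  rewrite -lee_fin [leRHS]fineK; last exact: iint_fin_num.
  rewrite -iint_Rintegral//; apply: iint_subset => //.
  by move=> t; rewrite /= !in_itv/= andbT => /andP[].
by exists x0 => x /H; rewrite primB// lerDl.
Qed.

Lemma iint_left_tail f e : continuous f -> (forall x, 0 <= f x) ->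
  (\iint_`]-oo, 0%R] f < +oo)%E -> 0 < e ->
  exists x0, forall x, x <= x0 -> \int[mu]_(t in `[x - 1, x]) f t < e.
Proof.
move=> cf f0 fI e0; have lf := loc_integrable_continuous cf.
have Jm : {homo prim 0 f : x y / x <= y}.
  by move=> x y xy; rewrite -subr_ge0 primB// Rintegral_ge0.
(* Reflection turns the behaviour at -oo into that of a nondecreasing function at +oo. *)
have Jm' : {homo (fun x => - prim 0 f (- x)) : x y / x <= y}.
  by move=> x y xy; rewrite lerN2 Jm// lerN2.
have [|x0 H] := bounded_increment (M := fine (\iint_`]-oo, 0%R] f)) Jm' _ e0.
  move=> x; rewrite lerNl.
  apply: (le_trans _ (Jm (Num.min 0 (- x)) _ _)); last by rewrite ge_min lexx orbT.
  have m0 : Num.min 0 (- x) <= 0 by rewrite ge_min lexx.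
  have -> : prim 0 f (Num.min 0 (- x)) = - \int[mu]_(t in `[Num.min 0 (- x), 0]) f t.
    by rewrite -(primB 0 lf m0) prim_base sub0r opprK.
  rewrite lerN2.
  rewrite -lee_fin [leRHS]fineK; last exact: iint_fin_num.
  rewrite -iint_Rintegral//; apply: iint_subset => //.
  by move=> t; rewrite /= !in_itv/= => /andP[].
exists (- x0) => x xx0; have := H (- x); rewrite lerNr => /(_ xx0).
have -> : - (- x + 1) = x - 1 by ring.
rewrite !opprK (_ : - prim 0 f (x - 1) + prim 0 f x = prim 0 f x - prim 0 f (x - 1)); last by ring.
by rewrite primB// gerBl.
Qed.

End NonnegIntegrals.

(** * Square integrable solutions *)

Section WeylSolutions.
Context {R : realType}.
Local Notation mu := (@lebesgue_measure R).
Local Notation C := R[i].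
Local Notation Re := (@complex.Re R).
Local Notation Im := (@complex.Im R).
Implicit Types (f g : R -> C) (q : R -> C) (z w : C) (F G H Phi Psi : R -> C * C)
  (a b c r s t x : R) (A : set R).

Lemma iint_vnorm A F : (\int[mu]_(x in A) ((vnorm F x) ^+ 2)%:E = \iint_A (sqnorm F))%E.
Proof. by apply: eq_integral => x _; rewrite vnorm_sqr. Qed.

Lemma sol_cmeas q z G F A : sol q z G F ->
  cmeas A (fun x => (F x).1) /\ cmeas A (fun x => (F x).2).
Proof.
move=> [/cacd_continuous[f1 f2] /cacd_continuous[f3 f4]].
by split; split; apply: measurable_funTS; exact: continuous_measurable_fun.
Qed.

Lemma sol_L2on q z G F A : sol q z G F -> (\iint_A (sqnorm F) < +oo)%E -> L2on A F.
Proof.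
by move=> FG FA; have [m1 m2] := sol_cmeas A FG; split=> //; split=> //; rewrite iint_vnorm.
Qed.

Lemma L2on_lty A F : L2on A F -> (\iint_A (sqnorm F) < +oo)%E.
Proof. by move=> [_ [_]]; rewrite iint_vnorm. Qed.

Lemma cmeas_sqnorm A F : cmeas A (fun x => (F x).1) -> cmeas A (fun x => (F x).2) ->
  measurable_fun A (sqnorm F).
Proof.
move=> [m1 m2] [m3 m4].
by apply: measurable_funD; apply: measurable_funD; apply: measurable_funX.
Qed.

Lemma cmeasB A f g : cmeas A f -> cmeas A g -> cmeas A (fun x => f x - g x).
Proof.
move=> [f1 f2] [g1 g2]; split.
  rewrite (_ : _ \o _ = (fun x => Re (f x) - Re (g x))); first exact: measurable_funB.
  by apply/funext => x /=; rewrite !ReImE.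
rewrite (_ : _ \o _ = (fun x => Im (f x) - Im (g x))); first exact: measurable_funB.
by apply/funext => x /=; rewrite !ReImE.
Qed.

Lemma cmeasZ A z f : cmeas A f -> cmeas A (fun x => z * f x).
Proof.
move=> [f1 f2]; split.
  rewrite (_ : _ \o _ = (fun x => Re z * Re (f x) - Im z * Im (f x))).
    by apply: measurable_funB; apply: measurable_funM => //; exact: measurable_cst.
  by apply/funext => x /=; rewrite !ReImE.
rewrite (_ : _ \o _ = (fun x => Re z * Im (f x) + Im z * Re (f x))).
  by apply: measurable_funD; apply: measurable_funM => //; exact: measurable_cst.
by apply/funext => x /=; rewrite !ReImE.
Qed.

Lemma mul_ii : 'i%C * 'i%C = -1 :> C.
Proof. by rewrite -expr2 sqr_i. Qed.

Lemma Dgraph_sol q z F H G : Dgraph q F H ->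
  {ae mu, forall x, G x = ((H x).1 - z * (F x).1, (H x).2 - z * (F x).2)} ->
  sol q z G F.
Proof.
move=> [_ [[ac1 ac2] [_ dF]]] GH; split.
  apply: (derivable_cacd ac1); apply: filterS2 dF GH => x [[d1 d2] ->] -> /=; split=> //.
  apply/eqP; rewrite -subr_eq0; apply/eqP.
  have -> : 'i%C * ('i%C * (cder (fun y => (F y).1) x - q x * (F x).2) - z * (F x).1) =
    - (cder (fun y => (F y).1) x - q x * (F x).2) - 'i%C * z * (F x).1.
    by rewrite mulrBr !mulrA mul_ii mulN1r.
  by ring.
apply: (derivable_cacd ac2); apply: filterS2 dF GH => x [[d1 d2] ->] -> /=; split=> //.
apply/eqP; rewrite -subr_eq0; apply/eqP.
have -> : 'i%C * ('i%C * (- conjc (q x) * (F x).1 - cder (fun y => (F y).2) x) - z * (F x).2) =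
  - (- conjc (q x) * (F x).1 - cder (fun y => (F y).2) x) - 'i%C * z * (F x).2.
  by rewrite mulrBr !mulrA mul_ii mulN1r.
by ring.
Qed.

Lemma wave_sol0 q z Phi : wave q z Phi -> sol0 q z Phi.
Proof.
move=> [[ac1 ac2] [_ dP]]; split.
  apply: (derivable_cacd ac1); apply: filterS dP => x [[d1 d2] [e1 e2]] /=; split=> //.
  by rewrite e1; ring.
apply: (derivable_cacd ac2); apply: filterS dP => x [[d1 d2] [e1 e2]] /=; split=> //.
by rewrite e2; ring.
Qed.

Lemma sol0_wave q z Phi x : sol0 q z Phi -> Phi x <> (0, 0) -> wave q z Phi.
Proof.
move=> [/cacd_derivable[ac1 d1] /cacd_derivable[ac2 d2]] Px; split=> //.
split; first by exists x.
by apply: filterS2 d1 d2 => t [d1 e1] [d2 e2]; split=> //; rewrite e1 e2; split=> /=; ring.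
Qed.

Lemma sol0_neq0 q z Phi c x : sol0 q z Phi -> Phi c <> (0, 0) -> Phi x <> (0, 0).
Proof.
move=> P Pc Px; apply: Pc.
(* A zero at x is read as proportionality of Phi to itself with factor 0. *)
have Px0 : Phi x = (0 * (Phi x).1, 0 * (Phi x).2) by rewrite !mul0r.
by rewrite (sol0_agree P P Px0 c) !mul0r.
Qed.

Lemma sol0_sqnorm_gt0 q z Phi c x : sol0 q z Phi -> Phi c <> (0, 0) -> 0 < sqnorm Phi x.
Proof.
move=> P Pc; rewrite lt_neqAle sqnorm_ge0 andbT eq_sym; apply/eqP => /sqnorm_eq0.
exact: sol0_neq0 P Pc.
Qed.

Lemma iint_sol0_gt0 q z Phi c a b : sol0 q z Phi -> Phi c <> (0, 0) -> a < b ->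
  (0 < \iint_`[a, b] (sqnorm Phi))%E.
Proof.
(* By [sol_growth], |Phi|^2 stays on [a, b] above its value at a divided by the growth factor over
   the whole interval. *)
move=> P Pc ab; pose d := sqnorm Phi a / expR (2 * `|Im z| * (b - a)).
have d0 : 0 < d by rewrite divr_gt0 ?expR_gt0// (sol0_sqnorm_gt0 _ P Pc).
have muab : mu `[a, b] = (b - a)%:E by rewrite lebesgue_measure_itv/= lte_fin ab.
apply: (@lt_le_trans _ _ (d%:E * mu `[a, b])%E).
  by rewrite muab mule_gt0// lte_fin subr_gt0.
apply: iint_ge_cst => //; [exact: sol_sqnorm_continuous P | exact: ltW |].
move=> x /=; rewrite in_itv/= => /andP[ax xb].
rewrite /d ler_pdivrMr ?expR_gt0// mulrC.
have [//|_ +] := sol_growth P ax; move=> /le_trans; apply.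
rewrite ler_wpM2r ?sqnorm_ge0// ler_expR ler_wpM2l ?mulr_ge0// lerD2r//.
Qed.

(** Surjectivity and the bound on the inverse in one statement, with the equation in the form [sol].
    That c does not depend on G makes the final estimate uniform in r. *)
Definition solve_bound q z c := forall G, L2on setT G ->
  exists F, [/\ sol q z G F, (\iint_setT (sqnorm F) < +oo)%E &
    (\iint_setT (sqnorm F) <= c%:E * \iint_setT (sqnorm G))%E].

Lemma resolvent_solve q z : resolvent q z -> exists c, solve_bound q z c.
Proof.
move=> [surj [c hc]]; exists c => G L2G.
have [F [H [D GH]]] := surj G L2G.
exists F; split; first exact: Dgraph_sol D GH.
  by case: D => /L2on_lty.
have := hc F H D; rewrite /L2norm2 !iint_vnorm => /le_trans; apply.
(* The resolvent bound is in terms of H - zF, which is G only almost everywhere; the two norms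
   agree. *)
rewrite le_eqVlt; apply/orP; left; apply/eqP; congr (_ * _)%E.
have [mF1 [mF2 _]] := D.1; have [mH1 [mH2 _]] := D.2.2.1.
have [mG1 [mG2 _]] := L2G.
apply: ge0_ae_eq_integral => //.
- by apply/measurable_EFinP; apply: cmeas_sqnorm; apply: cmeasB => //; exact: cmeasZ.
- by apply/measurable_EFinP; exact: cmeas_sqnorm.
- by move=> x _; rewrite lee_fin sqnorm_ge0.
- by move=> x _; rewrite lee_fin sqnorm_ge0.
by apply: filterS GH => x Gx _; rewrite /sqnorm Gx.
Qed.

(** Such a Phi satisfies D(q) Phi = z Phi, so the bound on the inverse forces its norm to be 0,
    whereas a nonzero solution has positive mass on [0, 1]. *)
Lemma resolvent_injective q z Phi : resolvent q z -> sol0 q z Phi ->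
  (\iint_setT (sqnorm Phi) < +oo)%E -> forall x, Phi x = (0, 0).
Proof.
move=> [_ [c hc]] P PL x; apply: contrapT => Px.
pose H t := (z * (Phi t).1, z * (Phi t).2).
have [mP1 mP2] := sol_cmeas setT P.
have D : Dgraph q Phi H.
  have [/cacd_derivable[ac1 d1] /cacd_derivable[ac2 d2]] := P.
  split; first exact: sol_L2on P PL.
  split=> //; split.
    split; first exact: cmeasZ.
    split; first exact: cmeasZ.
    rewrite iint_vnorm (_ : sqnorm H = (fun t => cabs2 z * sqnorm Phi t)); last first.
      by apply/funext => t; exact: sqnormZ.
    under eq_integral do rewrite EFinM.
    rewrite ge0_integralZl_EFin ?cabs2_ge0//.
    - by rewrite lte_mul_pinfty ?lee_fin ?cabs2_ge0.
    - by move=> t _; rewrite lee_fin sqnorm_ge0.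
    - by apply/measurable_EFinP; exact: cmeas_sqnorm.
  apply: filterS2 d1 d2 => t [d1 e1] [d2 e2]; split=> //.
  rewrite /H /Mq e1 e2 /=; congr (_, _).
    by transitivity (- ('i%C * 'i%C) * (z * (Phi t).1)); [rewrite mul_ii; ring | ring].
  by transitivity (- ('i%C * 'i%C) * (z * (Phi t).2)); [rewrite mul_ii; ring | ring].
have := hc Phi H D; rewrite /L2norm2 iint_vnorm [X in (_ <= _ * X)%E](_ : _ = 0%E).
  rewrite mule0 => H0.
  have := iint_sol0_gt0 P Px (ltr01 : 0 < 1 :> R); rewrite ltNge => /negP; apply.
  apply: le_trans H0; apply: iint_subset => //; [exact: sol_sqnorm_continuous P | exact: sqnorm_ge0].
apply: integral0_eq => t _; rewrite /vnorm/= !subrr /cabs2/= expr0n/= !addr0 sqrtr0.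
by rewrite expr0n.
Qed.

(** By the arithmetic-geometric mean inequality the constant |W| is at most |Phi|^2 + |Psi|^2
    pointwise, and a positive constant is not integrable over a set of infinite measure. *)
Lemma wronskian_L2 q z Phi Psi A : sol0 q z Phi -> sol0 q z Psi ->
  measurable A -> mu A = +oo%E ->
  (\iint_A (sqnorm Phi) < +oo)%E -> (\iint_A (sqnorm Psi) < +oo)%E ->
  forall x, wronskian Phi Psi x = 0.
Proof.
move=> P Ps mA muA PA PsA x; apply/eqP; rewrite -cabs2_eq0; apply: contrapT => /negP W0.
pose d := Num.sqrt (cabs2 (wronskian Phi Psi x)).
have d0 : 0 < d by rewrite sqrtr_gt0 lt_neqAle cabs2_ge0 andbT eq_sym.
have cP := sol_sqnorm_continuous P; have cPs := sol_sqnorm_continuous Ps.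
have cS : continuous (fun t => sqnorm Phi t + sqnorm Psi t).
  by move=> t; apply: cvgD; [exact: cP | exact: cPs].
have : (\iint_A (fun t => sqnorm Phi t + sqnorm Psi t)%R = +oo)%E.
  apply: (iint_infinite (c := d)) => // t _.
  have := cabs2_wronskian Phi Psi t; rewrite (wronskian_cst Ps P t x) -/d.
  rewrite -(sqr_sqrtr (cabs2_ge0 _)) -/d.
  have := sqnorm_ge0 Phi t; have := sqnorm_ge0 Psi t; nra.
have -> : (\iint_A (fun t => sqnorm Phi t + sqnorm Psi t)%R = \iint_A (sqnorm Phi) + \iint_A (sqnorm Psi))%E.
  under eq_integral do rewrite EFinD.
  apply: ge0_integralD => //.
  - by move=> t _; rewrite lee_fin sqnorm_ge0.
  - exact: continuous_measurable_EFin.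
  - by move=> t _; rewrite lee_fin sqnorm_ge0.
  - exact: continuous_measurable_EFin.
by move=> E; move: (lte_add_pinfty PA PsA); rewrite E ltxx.
Qed.

Lemma mu_right r : mu `[r, +oo[ = +oo%E.
Proof. by rewrite lebesgue_measure_itv/= ltry. Qed.

Lemma mu_left r : mu `]-oo, r] = +oo%E.
Proof. by rewrite lebesgue_measure_itv/= ltNyr. Qed.

End WeylSolutions.

(** * Weyl solutions *)

Section WeylPair.
Context {R : realType}.
Local Notation mu := (@lebesgue_measure R).
Local Notation C := R[i].
Local Notation Re := (@complex.Re R).
Local Notation Im := (@complex.Im R).
Implicit Types (f g : R -> C) (q : R -> C) (z w : C) (F G H Phi Psi : R -> C * C)
  (a b c r s t x k : R) (A : set R).

Definition L2right Phi := (\iint_`[0%R, +oo[ (sqnorm Phi) < +oo)%E.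
Definition L2left Phi := (\iint_`]-oo, 0%R] (sqnorm Phi) < +oo)%E.

(** Swapping and conjugating the components turns the source term of [wronskian_acd] into i|Phi|^2
    on [s, r], while the pointwise norm there remains that of Phi. *)
Definition dual_cutoff s r Phi x : C * C :=
  if (s <= x <= r) then (conjc (Phi x).2, conjc (Phi x).1) else (0, 0).

Lemma iint_dual_cutoff s r Phi :
  (\iint_setT (sqnorm (dual_cutoff s r Phi)) = \iint_`[s, r] (sqnorm Phi))%E.
Proof.
rewrite [RHS]integral_mkcond; apply: eq_integral => x _.
rewrite patchE mem_setE in_itv/= /sqnorm /dual_cutoff; case: ifP => _.
  by rewrite /cabs2/= !ReImE; congr EFin; ring.
by rewrite /cabs2/= expr0n/= !addr0.
Qed.

Lemma dual_cutoff_L2 q z s r Phi : sol0 q z Phi -> L2on setT (dual_cutoff s r Phi).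
Proof.
move=> P; have cP := sol_sqnorm_continuous P.
have [[m1 m2] [m3 m4]] := sol_cmeas `[s, r] P.
have key (h u : R -> R) : measurable_fun `[s, r] h ->
    (forall x, u x = if s <= x <= r then h x else 0) -> measurable_fun setT u.
  move=> mh uE; rewrite (_ : u = h \_ `[s, r]); first exact: (measurable_restrictT h (measurable_itv `[s, r])).1.
  by apply/funext => x; rewrite patchE mem_setE in_itv/= uE.
have n2 := measurable_funN m2; have n4 := measurable_funN m4.
split.
  by split; [apply: (key _ _ m3) | apply: (key _ _ n4)] => x;
    rewrite /= /dual_cutoff; case: ifP => //= _; rewrite ReImE.
split.
  by split; [apply: (key _ _ m1) | apply: (key _ _ n2)] => x;
    rewrite /= /dual_cutoff; case: ifP => //= _; rewrite ReImE.
by rewrite iint_vnorm iint_dual_cutoff; exact: iint_segment_lty.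
Qed.

(** F solves the homogeneous system only outside [s, r]. [PhiL] and [PhiR] are the global solutions
    with the values of F at s and at r: they inherit its integrability at the two ends, and their
    constant wronskians with Phi are those of F at s and at r. *)
Lemma cutoff_solutions q z k s r Phi : cLloc1 q -> solve_bound q z k ->
  sol0 q z Phi -> s <= r -> exists PhiL PhiR,
  [/\ sol0 q z PhiL, sol0 q z PhiR, L2left PhiL & L2right PhiR] /\
  [/\ forall x, wronskian Phi PhiR x - wronskian Phi PhiL x =
     (0 +i* \int[mu]_(x in `[s, r]) sqnorm Phi x)%C &
    (\iint_`[r, +oo[ (sqnorm PhiR) <= k%:E * \iint_`[s, r] (sqnorm Phi))%E].
Proof.
move=> lq hk P sr; have cP := sol_sqnorm_continuous P.
have [F [FG FI Fk]] := hk _ (dual_cutoff_L2 s r P).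
rewrite iint_dual_cutoff in Fk.
have cF := sol_sqnorm_continuous FG.
have [PL SL EL] := sol0_exists z s (F s) lq.
have [PR SR ER] := sol0_exists z r (F r) lq.
have cPL := sol_sqnorm_continuous SL; have cPR := sol_sqnorm_continuous SR.
have FL x : x <= s -> F x = PL x.
  move=> xs; have H : F s = (1 * (PL s).1, 1 * (PL s).2).
    by rewrite EL !mul1r -surjective_pairing.
  have := sol_agree FG SL H (a := x) (b := s); rewrite xs lexx /= => /(_ isT) H'.
  rewrite (H' _ x) ?lexx// ?mul1r -?surjective_pairing//.
  (* [sol_agree] asks for a vanishing source on the open interval only, so the value of the cutoff
     at s does no harm. *)
  by move=> t /andP[_ ts]; rewrite /dual_cutoff leNgt ts.
have FR x : r <= x -> F x = PR x.
  move=> rx; have H : F r = (1 * (PR r).1, 1 * (PR r).2).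
    by rewrite ER !mul1r -surjective_pairing.
  have := sol_agree FG SR H (a := r) (b := x); rewrite rx lexx /= => /(_ isT) H'.
  rewrite (H' _ x) ?lexx ?rx// ?mul1r -?surjective_pairing//.
  by move=> t /andP[rt _]; rewrite /dual_cutoff [t <= r]leNgt rt andbF.
have IR : (\iint_`[r, +oo[ (sqnorm PR) <= \iint_setT (sqnorm F))%E.
  rewrite (_ : \iint_`[r, +oo[ (sqnorm PR) = \iint_`[r, +oo[ (sqnorm F))%E.
    by apply: iint_subset => //; exact: sqnorm_ge0.
  by apply: eq_integral => x; rewrite inE/= in_itv/= andbT => rx; rewrite /sqnorm FR.
have IL : (\iint_`]-oo, s] (sqnorm PL) <= \iint_setT (sqnorm F))%E.
  rewrite (_ : \iint_`]-oo, s] (sqnorm PL) = \iint_`]-oo, s] (sqnorm F))%E.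
    by apply: iint_subset => //; exact: sqnorm_ge0.
  by apply: eq_integral => x; rewrite inE/= in_itv/= => xs; rewrite /sqnorm FL.
exists PL, PR; split.
  split=> //.
    by apply: (iint_left_lty 0 cPL (sqnorm_ge0 _)); exact: le_lt_trans IL FI.
  by apply: (iint_right_lty 0 cPR (sqnorm_ge0 _)); exact: le_lt_trans IR FI.
split; last exact: le_trans IR Fk.
move=> x; rewrite (wronskian_cst SR P x r) (wronskian_cst SL P x s).
have -> : wronskian Phi PR r = wronskian Phi F r by rewrite /wronskian FR.
have -> : wronskian Phi PL s = wronskian Phi F s by rewrite /wronskian FL.
have [wr wi] := wronskian_acd FG P.
have GE t : s < t < r -> 'i%C * ((Phi t).1 * (dual_cutoff s r Phi t).2 +
    (Phi t).2 * (dual_cutoff s r Phi t).1) = (0 +i* sqnorm Phi t)%C.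
  move=> /andP[st tr]; rewrite /dual_cutoff (ltW st) (ltW tr) /=.
  by apply: ReIm_eq; rewrite !ReImE/= /sqnorm /cabs2; ring.
have e1 : Re (wronskian Phi F r) - Re (wronskian Phi F s) = 0.
  rewrite (acd_eq sr wr (acd_cst 0)) ?subrr//.
  by apply: aeW => t /GE ->.
have e2 : Im (wronskian Phi F r) - Im (wronskian Phi F s) = \int[mu]_(x in `[s, r]) sqnorm Phi x.
  have lP := loc_integrable_continuous cP.
  rewrite (acd_eq sr wi (prim_acd s lP)) ?primB//.
  by apply: aeW => t /GE ->.
by apply: ReIm_eq; [rewrite ReD ReN; exact: e1 | rewrite ImD ImN; exact: e2].
Qed.

Lemma exists_nonzero_sol q z : cLloc1 q -> exists2 Phi, sol0 q z Phi & Phi 0 <> (0, 0).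
Proof.
move=> lq; have [Phi P P0] := sol0_exists z 0 (1, 0) lq.
exists Phi => //; rewrite P0 => -[/eqP]; by rewrite oner_eq0.
Qed.

(** If only 0 were square integrable at the left, every left piece would vanish, and each nonzero
    Phi would have a right piece with nonzero wronskian. Taking for Phi such a right piece
    contradicts [wronskian_L2]. The other end is symmetric. *)
Lemma weyl_exists q z k : cLloc1 q -> solve_bound q z k ->
  (exists Pm, [/\ sol0 q z Pm, L2left Pm & Pm 0 <> (0, 0)]) /\
  (exists Pp, [/\ sol0 q z Pp, L2right Pp & Pp 0 <> (0, 0)]).
Proof.
move=> lq hk; have [Phi0 P0 P00] := exists_nonzero_sol z lq.
have step Phi : sol0 q z Phi -> Phi 0 <> (0, 0) -> exists PhiL PhiR,
    [/\ sol0 q z PhiL, sol0 q z PhiR, L2left PhiL & L2right PhiR] /\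
    wronskian Phi PhiR 0 - wronskian Phi PhiL 0 <> 0.
  move=> P Pn; have [PL [PR [h1 [h2 _]]]] := cutoff_solutions lq hk P ler01.
  exists PL, PR; split=> //; rewrite h2 => -[] /eqP.
  rewrite gt_eqF// -lte_fin -iint_Rintegral; last exact: sol_sqnorm_continuous P.
  exact: iint_sol0_gt0 P Pn ltr01.
have w0 Phi Psi : Psi 0 = (0, 0) -> wronskian Phi Psi 0 = 0.
  by move=> Ps0; rewrite /wronskian Ps0 !mulr0 subrr.
split; apply: contrapT => N.
- have Z Psi : sol0 q z Psi -> L2left Psi -> Psi 0 = (0, 0).
    by move=> Ps PsL; apply: contrapT => Psn; apply: N; exists Psi.
  have [PL [PR [[sL sR lL lR] W]]] := step _ P0 P00.
  rewrite [X in _ - X]w0 ?subr0 in W; last exact: Z.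
  have PRn : PR 0 <> (0, 0) by move=> /(w0 Phi0).
  (* The second application has the right piece of the first as its Phi. *)
  have [PL' [PR' [[sL' sR' lL' lR'] W']]] := step _ sR PRn.
  apply: W'; rewrite [X in _ - X]w0 ?subr0; last exact: Z.
  exact: (wronskian_L2 sR sR' _ (mu_right 0) lR lR').
- have Z Psi : sol0 q z Psi -> L2right Psi -> Psi 0 = (0, 0).
    by move=> Ps PsL; apply: contrapT => Psn; apply: N; exists Psi.
  have [PL [PR [[sL sR lL lR] W]]] := step _ P0 P00.
  rewrite [X in X - _]w0 ?sub0r in W; last exact: Z.
  have PLn : PL 0 <> (0, 0) by move=> /(w0 Phi0) PL0; apply: W; rewrite PL0 oppr0.
  have [PL' [PR' [[sL' sR' lL' lR'] W']]] := step _ sL PLn.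
  apply: W'; rewrite [X in X - _]w0 ?sub0r; last exact: Z.
  by rewrite (wronskian_L2 sL sL' _ (mu_left 0) lL lL') ?oppr0.
Qed.

(** If the wronskian vanished, Pp would be a multiple of Pm, hence square integrable at both ends,
    against injectivity. *)
Lemma wronskian_neq0 q z Pm Pp : resolvent q z -> sol0 q z Pm -> sol0 q z Pp ->
  L2left Pm -> L2right Pp -> Pm 0 <> (0, 0) -> Pp 0 <> (0, 0) ->
  forall x, wronskian Pm Pp x <> 0.
Proof.
move=> rz sm sp lm lp m0 p0 x; rewrite (wronskian_cst sp sm x 0) => W0.
have [w Hw] := wronskian0_proportional sp sm m0 W0.
apply: p0; apply: (resolvent_injective rz sp).
apply: (iint_setT_lty (sol_sqnorm_continuous sp) (sqnorm_ge0 _) _ lp (r := 0)).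
under eq_integral => t _ do rewrite (sqnormZ (Hw t)) EFinM.
rewrite ge0_integralZl_EFin ?cabs2_ge0//.
- by rewrite lte_mul_pinfty ?lee_fin ?cabs2_ge0.
- by move=> t _; rewrite lee_fin sqnorm_ge0.
- by apply: continuous_measurable_EFin; exact: sol_sqnorm_continuous sm.
Qed.

Lemma weyl_decay_right q z Phi : sol0 q z Phi -> L2right Phi ->
  vnorm Phi x @[x --> +oo] --> (0 : R).
Proof.
move=> P PL; have cP := sol_sqnorm_continuous P.
suff H : sqnorm Phi x @[x --> +oo] --> (0 : R).
  by rewrite -[X in _ --> X]sqrtr0; apply: cvg_comp H _; exact: sqrt_continuous.
(* K is the growth factor over unit length: throughout [x, x + 1], |Phi|^2 is at least its value at
   x divided by K. *)
pose K := expR (2 * `|Im z| * 1); have K0 : 0 < K := expR_gt0 _.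
apply/cvgrPdist_lt => e e0.
have [x0 hx0] := iint_right_tail cP (sqnorm_ge0 _) PL (divr_gt0 e0 K0).
exists x0; split; first exact: num_real.
move=> x /ltW/hx0 H; rewrite sub0r normrN ger0_norm ?sqnorm_ge0//.
move: H; rewrite ltr_pdivlMr//; apply: le_lt_trans.
rewrite -ler_pdivrMr//.
have -> : sqnorm Phi x / K = \int[mu]_(t in `[x, x + 1]) (sqnorm Phi x / K).
  have mux : fine (mu `[x, x + 1]) = 1.
    by rewrite lebesgue_measure_itv/= lte_fin ltrDl ltr01 -EFinB/= addrAC subrr add0r.
  rewrite Rintegral_cst//; transitivity (sqnorm Phi x / K * 1); first by rewrite mulr1.
  by congr (_ * _); exact/esym/mux.
apply: le_Rintegral => //.
- by apply: loc_integrable_continuous => t; exact: cst_continuous.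
- exact: loc_integrable_continuous.
move=> t; rewrite /= in_itv/= => /andP[xt tx].
have [//|_ +] := sol_growth P xt; rewrite ler_pdivrMr// mulrC => /le_trans; apply.
rewrite ler_wpM2l ?sqnorm_ge0// ler_expR ler_wpM2l ?mulr_ge0//; lra.
Qed.

Lemma weyl_decay_left q z Phi : sol0 q z Phi -> L2left Phi ->
  vnorm Phi x @[x --> -oo] --> (0 : R).
Proof.
move=> P PL; have cP := sol_sqnorm_continuous P.
suff H : sqnorm Phi x @[x --> -oo] --> (0 : R).
  by rewrite -[X in _ --> X]sqrtr0; apply: cvg_comp H _; exact: sqrt_continuous.
pose K := expR (2 * `|Im z| * 1); have K0 : 0 < K := expR_gt0 _.
apply/cvgrPdist_lt => e e0.
have [x0 hx0] := iint_left_tail cP (sqnorm_ge0 _) PL (divr_gt0 e0 K0).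
exists x0; split; first exact: num_real.
move=> x /ltW/hx0 H; rewrite sub0r normrN ger0_norm ?sqnorm_ge0//.
move: H; rewrite ltr_pdivlMr//; apply: le_lt_trans.
rewrite -ler_pdivrMr//.
have -> : sqnorm Phi x / K = \int[mu]_(t in `[x - 1, x]) (sqnorm Phi x / K).
  have mux : fine (mu `[x - 1, x]) = 1.
    by rewrite lebesgue_measure_itv/= lte_fin gtrBl ltr01 -EFinB/= opprB addrC subrK.
  rewrite Rintegral_cst//; transitivity (sqnorm Phi x / K * 1); first by rewrite mulr1.
  by congr (_ * _); exact/esym/mux.
apply: le_Rintegral => //.
- by apply: loc_integrable_continuous => t; exact: cst_continuous.
- exact: loc_integrable_continuous.
move=> t; rewrite /= in_itv/= => /andP[xt tx].
have [//|+ _] := sol_growth P tx; rewrite ler_pdivrMr// mulrC => /le_trans; apply.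
rewrite ler_wpM2l ?sqnorm_ge0// ler_expR ler_wpM2l ?mulr_ge0//; lra.
Qed.

Lemma vnorm_gt0 q z Phi x : sol0 q z Phi -> Phi 0 <> (0, 0) -> 0 < vnorm Phi x.
Proof. by move=> P P0; rewrite sqrtr_gt0 (sol0_sqnorm_gt0 x P P0). Qed.

Lemma vnorm_inv_le q z Phi Psi x : sol0 q z Phi -> sol0 q z Psi ->
  Phi 0 <> (0, 0) -> wronskian Phi Psi 0 <> 0 ->
  (vnorm Phi x)^-1 <= vnorm Psi x / Num.sqrt (cabs2 (wronskian Phi Psi 0)).
Proof.
move=> P Ps P0 /eqP W0.
have w0 : 0 < Num.sqrt (cabs2 (wronskian Phi Psi 0)).
  by rewrite sqrtr_gt0 lt_neqAle cabs2_ge0 andbT eq_sym cabs2_eq0.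
rewrite -div1r ler_pdivrMr ?(vnorm_gt0 x P P0)// mulrAC ler_pdivlMr// mul1r.
rewrite /vnorm -sqrtrM ?sqnorm_ge0// ler_wsqrtr// mulrC.
by rewrite -(wronskian_cst Ps P x 0); exact: cabs2_wronskian.
Qed.

Lemma cvg_inv_squeeze (F : set_system R) (f g : R -> R) (K : R) : Filter F ->
  (forall x, 0 <= f x <= g x / K) -> g x @[x --> F] --> (0 : R) ->
  f x @[x --> F] --> (0 : R).
Proof.
move=> FF fg g0; apply: (@squeeze_cvgr _ _ _ _ (fun=> 0) (fun x => g x / K)).
- exact: nearW.
- exact: cvg_cst.
- by rewrite -[X in _ --> X](mul0r K^-1); apply: cvgM => //; exact: cvg_cst.
Qed.

Lemma vnorm_inv_rL2on q z Phi Psi A : sol0 q z Phi -> sol0 q z Psi ->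
  Phi 0 <> (0, 0) -> wronskian Phi Psi 0 <> 0 -> measurable A ->
  (\iint_A (sqnorm Psi) < +oo)%E -> rL2on A (fun x => (vnorm Phi x)^-1).
Proof.
move=> P Ps P0 W0 mA PsA; have cP := sol_sqnorm_continuous P.
have mV : measurable_fun setT (fun x => (vnorm Phi x)^-1).
  apply: continuous_measurable_fun => x; apply: continuousV.
    by rewrite gt_eqF// (vnorm_gt0 x P P0).
  by apply: (@continuous_comp _ _ _ (sqnorm Phi) Num.sqrt); [exact: cP | exact: sqrt_continuous].
split; first exact: measurable_funTS.
pose w := cabs2 (wronskian Phi Psi 0).
have w0 : 0 <= w^-1 by rewrite invr_ge0 cabs2_ge0.
apply: (@le_lt_trans _ _ (\int[mu]_(x in A) (w^-1%:E * (sqnorm Psi x)%:E))%E).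
  apply: ge0_le_integral => //.
  - by move=> x _; rewrite lee_fin sqr_ge0.
  - by apply/measurable_EFinP; apply: measurable_funX; exact: measurable_funTS.
  - apply: measurable_funeM; apply: continuous_measurable_EFin; exact: sol_sqnorm_continuous Ps.
  move=> x _; rewrite -EFinM lee_fin.
  have := vnorm_inv_le x P Ps P0 W0; rewrite -/w => h.
  have v0 : 0 <= (vnorm Phi x)^-1 by rewrite invr_ge0 sqrtr_ge0.
  have -> : w^-1 * sqnorm Psi x = (vnorm Psi x / Num.sqrt w) ^+ 2.
    by rewrite expr_div_n vnorm_sqr sqr_sqrtr ?cabs2_ge0// mulrC.
  by rewrite ler_sqr ?nnegrE// (le_trans v0).
rewrite ge0_integralZl_EFin//.
- by rewrite lte_mul_pinfty ?lee_fin.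
- by move=> t _; rewrite lee_fin sqnorm_ge0.
- by apply: continuous_measurable_EFin; exact: sol_sqnorm_continuous Ps.
Qed.

(** Let P and Q be the integrals of |Pm|^2 over [s, r] and of |Pp|^2 over [r, oo[. The left piece
    has wronskian 0 with Pm and the right piece is w Pp, so the jump gives |w|^2 |W|^2 = P^2, and
    the resolvent bound reads |w|^2 Q <= k P. Hence P Q <= k |W|^2, uniformly in s. *)
Lemma weyl_product_bound q z k Pm Pp : cLloc1 q -> solve_bound q z k ->
  sol0 q z Pm -> sol0 q z Pp -> L2left Pm -> L2right Pp ->
  Pm 0 <> (0, 0) -> Pp 0 <> (0, 0) -> forall r,
  (\iint_`]-oo, r] (sqnorm Pm) * \iint_`[r, +oo[ (sqnorm Pp) <=
     (k * cabs2 (wronskian Pm Pp 0))%:E)%E.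
Proof.
move=> lq hk sm sp lm lp m0 p0 r.
have cm := sol_sqnorm_continuous sm; have cp := sol_sqnorm_continuous sp.
(* This factor is finite and positive, so it can be divided out; the left integral is then exhausted
   by [s, r]. *)
have Qf := iint_fin_num (sqnorm_ge0 Pp) (iint_right_lty r cp (sqnorm_ge0 Pp) lp).
have Q0 : (0 < \iint_`[r, +oo[ (sqnorm Pp))%E.
  have r1 : r < r + 1 by rewrite ltrDl.
  apply: lt_le_trans (iint_sol0_gt0 sp p0 r1) _.
  apply: iint_subset => //; first exact: sqnorm_ge0.
  by move=> t; rewrite /= !in_itv/= andbT => /andP[].
move: Qf Q0; set QE := (\iint_`[r, +oo[ (sqnorm Pp))%E => Qf.
rewrite -(fineK Qf); set Q := fine _; rewrite lte_fin => Q0.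
rewrite -lee_pdivlMr// -EFinM.
apply: iint_left_le => //; first exact: sqnorm_ge0.
move=> s sr; have [PL [PR [[sL sR lL lR] [W B]]]] := cutoff_solutions lq hk sm (ltW sr).
have := iint_sol0_gt0 sm m0 sr; rewrite iint_Rintegral// in B *.
move: W B; set P := \int[mu]_(x in _) _ => W B; rewrite lte_fin => P0.
have [w Hw] : exists w, forall x, PR x = (w * (Pp x).1, w * (Pp x).2).
  apply: (wronskian0_proportional sR sp p0).
  exact: (wronskian_L2 sp sR _ (mu_right 0) lp lR).
have := W 0; rewrite (wronskian_L2 sm sL _ (mu_left 0) lm lL) // subr0.
have -> : wronskian Pm PR 0 = w * wronskian Pm Pp 0 by rewrite /wronskian Hw /=; ring.
have PE : cabs2 (0 +i* P)%C = P ^+ 2 by rewrite /cabs2/= expr0n/= add0r.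
move=> /(congr1 (@cabs2 R)); rewrite cabs2M PE => wP.
move: B; under eq_integral => t _ do rewrite (sqnormZ (Hw t)) EFinM.
rewrite ge0_integralZl_EFin ?cabs2_ge0//; last 2 first.
- by move=> t _; rewrite lee_fin sqnorm_ge0.
- exact: continuous_measurable_EFin.
rewrite -/QE -(fineK Qf) -/Q -!EFinM !lee_fin => B.
rewrite ler_pdivlMr//.
have := cabs2_ge0 (wronskian Pm Pp 0); move: wP B; set v := cabs2 w; set u := cabs2 _.
move=> wP B u0.
have : P ^+ 2 * Q <= k * P * u by rewrite -wP mulrAC; exact: ler_wpM2r.
by rewrite expr2 -mulrA [k * P]mulrC -mulrA ler_pM2l.
Qed.

Lemma weyl_pair_exists q z : cLloc1 q -> resolvent q z ->
  exists Pm Pp, weyl_pair q z Pm Pp.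
Proof.
move=> lq rz; have [k hk] := resolvent_solve rz.
have [[Pm [sm lm m0]] [Pp [sp lp p0]]] := weyl_exists lq hk.
exists Pm, Pp.
have cm := sol_sqnorm_continuous sm; have cp := sol_sqnorm_continuous sp.
have W := wronskian_neq0 rz sm sp lm lp m0 p0.
have W' : wronskian Pp Pm 0 <> 0.
  move=> W0; apply: (W 0); rewrite -[LHS]opprK -[RHS]oppr0 -W0; congr (- _).
  by rewrite /wronskian; ring.
have Lm r : (\iint_`]-oo, r] (sqnorm Pm) < +oo)%E := iint_left_lty r cm (sqnorm_ge0 _) lm.
have Lp r : (\iint_`[r, +oo[ (sqnorm Pp) < +oo)%E := iint_right_lty r cp (sqnorm_ge0 _) lp.
have vinv Phi x : 0 <= (vnorm Phi x)^-1 by rewrite invr_ge0 sqrtr_ge0.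
split; first exact: sol0_wave sm m0.
split; first exact: sol0_wave sp p0.
split.
  move=> a b /(_ 0) [h1 h2]; split; apply/eqP.
  (* Cramer's rule: eliminating b leaves a times the wronskian; below, eliminating a leaves b times
     it. *)
  - have : a * wronskian Pm Pp 0 = 0.
      transitivity ((a * (Pm 0).1 + b * (Pp 0).1) * (Pp 0).2 -
        (a * (Pm 0).2 + b * (Pp 0).2) * (Pp 0).1); first by rewrite /wronskian; ring.
      by rewrite h1 h2 !mul0r subrr.
    by move=> /eqP; rewrite mulf_eq0 => /orP[//|/eqP/W].
  - have : b * wronskian Pm Pp 0 = 0.
      transitivity ((Pm 0).1 * (a * (Pm 0).2 + b * (Pp 0).2) -
        (Pm 0).2 * (a * (Pm 0).1 + b * (Pp 0).1)); first by rewrite /wronskian; ring.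
      by rewrite h1 h2 !mulr0 subrr.
    by move=> /eqP; rewrite mulf_eq0 => /orP[//|/eqP/W].
split.
  move=> Phi /wave_sol0 P /(_ 0)/L2on_lty PL.
  apply: (wronskian0_proportional P sm m0).
  exact: (wronskian_L2 sm P _ (mu_left 0) lm PL).
split.
  move=> Phi /wave_sol0 P /(_ 0)/L2on_lty PL.
  apply: (wronskian0_proportional P sp p0).
  exact: (wronskian_L2 sp P _ (mu_right 0) lp PL).
split.
  move=> r; split; first exact: sol_L2on sm (Lm r).
  split; first exact: sol_L2on sp (Lp r).
  split; first exact: vnorm_inv_rL2on sm sp m0 (W 0) _ (Lp r).
  exact: vnorm_inv_rL2on sp sm p0 W' _ (Lm r).
split; first exact: weyl_decay_right sp lp.
split.
  apply: (cvg_inv_squeeze (K := Num.sqrt (cabs2 (wronskian Pp Pm 0)))) (weyl_decay_left sm lm) => x.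
  by rewrite vinv (vnorm_inv_le x sp sm p0 W').
split; first exact: weyl_decay_left sm lm.
split.
  apply: (cvg_inv_squeeze (K := Num.sqrt (cabs2 (wronskian Pm Pp 0)))) (weyl_decay_right sp lp) => x.
  by rewrite vinv (vnorm_inv_le x sm sp m0 (W 0)).
exists (k * cabs2 (wronskian Pm Pp 0)) => r; rewrite !iint_vnorm.
exact: (weyl_product_bound lq hk sm sp lm lp m0 p0).
Qed.

Lemma vnorm_Kop F : vnorm (Kop F) = vnorm F.
Proof.
apply/funext => x; rewrite /vnorm /cabs2 /Kop /= !ReImE; congr Num.sqrt; ring.
Qed.

Lemma L2on_Kop A F : L2on A F -> L2on A (Kop F).
Proof.
move=> [[m1 m2] [[m3 m4] I]]; rewrite /L2on vnorm_Kop; split; [|split=> //]; split.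
- by rewrite (_ : _ \o _ = Re \o (fun x => (F x).2))//; apply/funext => x /=; rewrite !ReImE.
- rewrite (_ : _ \o _ = (fun x => - Im (F x).2)); first exact: measurable_funN.
  by apply/funext => x /=; rewrite !ReImE.
- rewrite (_ : _ \o _ = (fun x => - Re (F x).1)); first exact: measurable_funN.
  by apply/funext => x /=; rewrite !ReImE.
- by rewrite (_ : _ \o _ = Im \o (fun x => (F x).1))//; apply/funext => x /=; rewrite !ReImE opprK.
Qed.

(** Conjugation exchanges the roles of the two equations and replaces z by its conjugate; the minus
    sign in K restores the signs of the potential terms. *)
Lemma sol0_Kop q z F : sol0 q z F -> sol0 q (conjc z) (Kop F).
Proof.
move=> [F1 F2]; split.
  apply: cacd_ae (cacd_conj F2) _; apply: aeW => x /=.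
  by apply: ReIm_eq; rewrite !ReImE/=; ring.
apply: cacd_ae (cacdN (cacd_conj F1)) _; apply: aeW => x /=.
by apply: ReIm_eq; rewrite !ReImE/=; ring.
Qed.

Lemma wave_Kop q z F : wave q z F -> wave q (conjc z) (Kop F).
Proof.
move=> wF; have [_ [[x Fx] _]] := wF.
apply: (@sol0_wave _ _ _ _ x); first exact: sol0_Kop (wave_sol0 wF).
move=> [/(congr1 (@conjc R)) h1 /(congr1 (fun u => conjc (- u))) h2]; apply: Fx.
move: h1 h2; rewrite opprK !conjcK oppr0 conjc0.
by case: (F x) => u v /= -> ->.
Qed.

Lemma weyl_pair_Kop q z Pm Pp : weyl_pair q z Pm Pp ->
  weyl_pair q (conjc z) (Kop Pm) (Kop Pp).
Proof.
move=> [wm [wp [ind [um [up [L2 lim]]]]]].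
(* K is antilinear with square -1: applying it to K Phi = w P gives -Phi = conj(w) K P. *)
have uniq (P : R -> C * C) Phi w :
    (forall x, Kop Phi x = (w * (P x).1, w * (P x).2)) ->
    forall x, Phi x = (- conjc w * (Kop P x).1, - conjc w * (Kop P x).2).
  move=> H x; case: (H x); case: (Phi x) => u v /= h1 h2; congr (_, _).
    rewrite -[u]opprK -[- u]conjcK rmorphN/= h2.
    by apply: ReIm_eq; rewrite !ReImE/=; ring.
  rewrite -[v]conjcK h1.
  by apply: ReIm_eq; rewrite !ReImE/=; ring.
split; first exact: wave_Kop.
split; first exact: wave_Kop.
split.
  move=> a b H; have [] := ind (conjc a) (conjc b).
    move=> x; have [h1 h2] := H x; split.
      move/(congr1 (fun u => conjc (- u))): h2; rewrite oppr0 conjc0 => <-.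
      by apply: ReIm_eq; rewrite !ReImE/=; ring.
    move/(congr1 (@conjc R)): h1; rewrite conjc0 => <-.
    by apply: ReIm_eq; rewrite !ReImE/=; ring.
  move=> /(congr1 (@conjc R)) ha /(congr1 (@conjc R)) hb.
  by move: ha hb; rewrite !conjcK conjc0.
split.
  move=> Phi /wave_Kop; rewrite conjcK => wPhi L2Phi.
  have [w Hw] := um _ wPhi (fun r => L2on_Kop (L2Phi r)).
  by exists (- conjc w); exact: uniq.
split.
  move=> Phi /wave_Kop; rewrite conjcK => wPhi L2Phi.
  have [w Hw] := up _ wPhi (fun r => L2on_Kop (L2Phi r)).
  by exists (- conjc w); exact: uniq.
rewrite !vnorm_Kop; split=> // r; have [h1 [h2 h3]] := L2 r.
by split; [exact: L2on_Kop | split; [exact: L2on_Kop | ]].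
Qed.

End WeylPair.

Theorem theorem5p4 (R : realType) (q : R -> R[i]) (z : R[i]) :
  cLloc1 q ->
  (exists w : R[i], resolvent q w) ->
  resolvent q z ->
  exists Pm Pp : R -> R[i] * R[i],
    weyl_pair q z Pm Pp /\ weyl_pair q (conjc z) (Kop Pm) (Kop Pp).
Proof.
move=> lq _ rz; have [Pm [Pp H]] := weyl_pair_exists lq rz.
by exists Pm, Pp; split; [exact: H | exact: weyl_pair_Kop].
Qed.
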